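(* Let $m\ge1$, $r>0$, and let $\alpha:I\to M$ be a regular $C^2$ curve parametrized by arc length, where $M=\mathbb{S}^{m+1}(r)$ or $M=\mathbb{H}^{m+1}(r)$, equipped with a rotation minimizing frame $\{\mathbf{t},\mathbf{n}_1,\dots,\mathbf{n}_m\}$ with associated curvatures $\kappa_1,\dots,\kappa_m$. Then $\alpha$ is a hyperplane curve, i.e., it lies on a totally geodesic hypersurface of $M$, if and only if the normal development $(\kappa_1,\dots,\kappa_m)$ lies on a hyperplane of $\mathbb{R}^m$ passing through the origin (a line through the origin when $m=2$); that is, if and only if there exist real constants $a_1,\dots,a_m$, not all zero, such that $\sum_{i=1}^m a_i\kappa_i(s)=0$ for all $s\in I$.
   Context: $\mathbb{S}^{m+1}(r)=\{q\in\mathbb{R}^{m+2}:\langle q,q\rangle_e=r^2\}$ with the metric induced by the Euclidean inner product $\langle\cdot,\cdot\rangle_e$. $\mathbb{H}^{m+1}(r)=\{q\in\mathbb{R}^{m+2}:\langle q,q\rangle_1=-r^2,\ x_1>0\}$ with the metric induced by $\langle x,y\rangle_1=-x_1y_1+\sum_{i=2}^{m+2}x_iy_i$. $I\subseteq\mathbb{R}$ is an interval, $\nabla$ is the Levi-Civita connection of $M$, and $\mathbf{t}=\alpha'$ is the unit tangent. A rotation minimizing (RM) frame along $\alpha$ is an orthonormal frame $\{\mathbf{t},\mathbf{n}_1,\dots,\mathbf{n}_m\}$ of $T_{\alpha(s)}M$ along $\alpha$ such that $\nabla_{\mathbf{t}}\mathbf{t}=\sum_{i=1}^m\kappa_i\mathbf{n}_i$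 and $\nabla_{\mathbf{t}}\mathbf{n}_i=-\kappa_i\mathbf{t}$ for $1\le i\le m$. The curve $s\mapsto(\kappa_1(s),\dots,\kappa_m(s))\in\mathbb{R}^m$ is called the normal development of $\alpha$. A submanifold $N\subset M$ is totally geodesic if every geodesic of $N$ (with the induced metric) is also a geodesic of $M$; hypersurfaces are assumed orientable. *)

(* Defs.v *)
From mathcomp Require Import all_boot all_order all_algebra.
From mathcomp Require Import all_classical all_reals all_analysis.

Set Implicit Arguments.
Unset Strict Implicit.
Unset Printing Implicit Defensive.

Import Order.TTheory GRing.Theory Num.Theory.
Import numFieldNormedType.Exports.

Local Open Scope classical_set_scope.
Local Open Scope ring_scope.

Inductive space_form := Sphere | Hyperbolic.

(* [<x, y>_e] for the sphere, [<x, y>_1] for the hyperbolic space; the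
   time-like coordinate x_1 is the one of index 0. *)
Definition ambient_form (R : realType) (m : nat) (g : space_form)
    (x y : 'rV[R]_m.+2) : R :=
  match g with
  | Sphere => \sum_i x 0 i * y 0 i
  | Hyperbolic => - (x 0 0 * y 0 0) +
      \sum_(i < m.+1) x 0 (lift ord0 i) * y 0 (lift ord0 i)
  end.

Definition ambient_space (R : realType) (m : nat) (g : space_form) (r : R) :
    set 'rV[R]_m.+2 :=
  match g with
  | Sphere => [set q | ambient_form Sphere q q = r ^+ 2]
  | Hyperbolic => [set q | ambient_form Hyperbolic q q = - r ^+ 2 /\ 0 < q 0 0]
  end.

(* Derivative relative to [I]: one-sided at the endpoints belonging to [I]. *)
Definition has_derivative_on (R : realType) (V : normedModType R)
    (I : set R) (f : R -> V) (s : R) (l : V) : Prop :=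
  (u - s)^-1 *: (f u - f s) @[u --> within I s^'] --> l.

Definition C2_on (R : realType) (V : normedModType R) (I : set R)
    (f : R -> V) : Prop :=
  exists f1 f2 : R -> V,
    [/\ forall s, I s -> has_derivative_on I f s (f1 s),
        forall s, I s -> has_derivative_on I f1 s (f2 s)
      & {within I, continuous f2}].

Fixpoint Ck_on (R : realType) (n : nat) (k : nat) (U : set 'rV[R]_n.+1)
    (f : 'rV[R]_n.+1 -> R) : Prop :=
  (forall x, U x -> {for x, continuous f}) /\
  match k with
  | 0%N => True
  | k'.+1 => forall i : 'I_n.+1,
      (forall x, U x -> derivable f x (delta_mx 0 i)) /\
      Ck_on k' U (fun x => 'D_(delta_mx 0 i) f x)
  end.

Definition smooth_on (R : realType) (n : nat) (U : set 'rV[R]_n.+1)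
    (f : 'rV[R]_n.+1 -> R) : Prop :=
  forall k, Ck_on k U f.

(* [v] is the velocity at [p] of a curve in [S]; on an embedded submanifold
   these vectors form the tangent space. *)
Definition tangent (R : realType) (n : nat) (S : set 'rV[R]_n.+1)
    (p v : 'rV[R]_n.+1) : Prop :=
  exists c : R -> 'rV[R]_n.+1,
    [/\ c 0 = p, is_derive (0 : R) 1 c v & \forall u \near (0 : R), S (c u)].

(* [u] is the covariant derivative at [s] of the field [w] along the curve [c]
   in [S], for the Levi-Civita connection of the metric induced on [S] by the
   ambient form, that is, the component tangent to [S] of the flat derivative
   of [w]. *)
Definition has_covariant_derivative (R : realType) (m : nat) (g : space_form)
    (S : set 'rV[R]_m.+2) (I : set R) (c w : R -> 'rV[R]_m.+2) (s : R)
    (u : 'rV[R]_m.+2) : Prop :=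
  exists l, [/\ has_derivative_on I w s l, tangent S (c s) u
    & forall v, tangent S (c s) v -> ambient_form g (l - u) v = 0].

Definition geodesic (R : realType) (m : nat) (g : space_form)
    (S : set 'rV[R]_m.+2) (J : set R) (c : R -> 'rV[R]_m.+2) : Prop :=
  [/\ forall s, J s -> S (c s), C2_on J c
    & exists v : R -> 'rV[R]_m.+2, forall s, J s ->
        has_derivative_on J c s (v s) /\
        has_covariant_derivative g S J c v s 0].

Definition hypersurface (R : realType) (m : nat) (g : space_form) (r : R)
    (N : set 'rV[R]_m.+2) : Prop :=
  let M := ambient_space g r in
  N `<=` M /\
  forall p, N p -> exists U : set 'rV[R]_m.+2, exists F : 'rV[R]_m.+2 -> R,
    [/\ open U, U p, smooth_on U F,
        forall x, U x -> M x -> (N x <-> F x = 0)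
      & forall x, U x -> N x -> exists2 v, tangent M x v & 'D_v F x != 0].

(* [M] being orientable, orientability of a hypersurface amounts to the
   existence of a continuous unit normal field. *)
Definition orientable (R : realType) (m : nat) (g : space_form) (r : R)
    (N : set 'rV[R]_m.+2) : Prop :=
  exists eta : 'rV[R]_m.+2 -> 'rV[R]_m.+2,
    {within N, continuous eta} /\
    forall p, N p ->
      [/\ tangent (ambient_space g r) p (eta p),
          ambient_form g (eta p) (eta p) = 1
        & forall v, tangent N p v -> ambient_form g (eta p) v = 0].

Definition totally_geodesic (R : realType) (m : nat) (g : space_form) (r : R)
    (N : set 'rV[R]_m.+2) : Prop :=
  forall (J : set R) (c : R -> 'rV[R]_m.+2),
    is_interval J -> interior J !=set0 ->
    geodesic g N J c -> geodesic g (ambient_space g r) J c.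

Definition arclength_C2_curve (R : realType) (m : nat) (g : space_form) (r : R)
    (I : set R) (alpha t : R -> 'rV[R]_m.+2) : Prop :=
  [/\ forall s, I s -> ambient_space g r (alpha s), C2_on I alpha
    & forall s, I s ->
        has_derivative_on I alpha s (t s) /\ ambient_form g (t s) (t s) = 1].

(* The [m.+1] orthonormal tangent vectors span the tangent space, of
   dimension [m.+1]. *)
Definition rm_frame (R : realType) (m : nat) (g : space_form) (r : R)
    (I : set R) (alpha t : R -> 'rV[R]_m.+2) (n : 'I_m -> R -> 'rV[R]_m.+2)
    (kappa : 'I_m -> R -> R) : Prop :=
  let M := ambient_space g r in
  forall s, I s ->
  [/\ tangent M (alpha s) (t s) /\ (forall i, tangent M (alpha s) (n i s)),
      ambient_form g (t s) (t s) = 1 /\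
        (forall i, ambient_form g (t s) (n i s) = 0),
      forall i j, ambient_form g (n i s) (n j s) = (i == j)%:R,
      has_covariant_derivative g M I alpha t s (\sum_i kappa i s *: n i s)
    & forall i, has_covariant_derivative g M I alpha (n i) s
                  (- kappa i s *: t s)].

Definition hyperplane_curve (R : realType) (m : nat) (g : space_form) (r : R)
    (I : set R) (alpha : R -> 'rV[R]_m.+2) : Prop :=
  exists N : set 'rV[R]_m.+2,
    [/\ hypersurface g r N, orientable g r N, totally_geodesic g r N
      & forall s, I s -> N (alpha s)].

Definition normal_development (R : realType) (m : nat)
    (kappa : 'I_m -> R -> R) (s : R) : 'rV[R]_m :=
  \row_i kappa i s.

(* Main.v *)
Require Import Defs.
From mathcomp Require Import all_boot all_order all_algebra.
From mathcomp Require Import all_classical all_reals all_analysis.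
From mathcomp Require Import ring lra.

(** The constants [a] of the theorem are the coordinates, in the frame
    [n 1, ..., n m], of the unit normal of the hypersurface along [alpha].

    Along a curve with a rotation minimizing frame, the flat derivative of [n i]
    is [- kappa i *: t] ([n_derivative]). So a combination [w] of the [n i] with
    constant coefficients [a] has derivative [- (\sum_i a i * kappa i) *: t],
    and a linear relation between the curvatures is the constancy of [w] as a
    vector of the ambient space. The curve then lies in the section of the
    quadric by the linear hyperplane orthogonal to [w], and such a section is a
    totally geodesic hypersurface: the acceleration of a curve in it is
    automatically orthogonal to [w]
    ([linear_section_totally_geodesic], [curvature_relation_hyperplane]).

    Conversely, let [alpha] lie in a totally geodesic hypersurface [N]. Near a
    point of [alpha], [N] is the zero set in the quadric of a smooth [F]. The
    assumption on [N] speaks of its geodesics, so some have to be produced. The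
    two constraints [form c c] constant and [F \o c = 0] determine the
    acceleration of a geodesic of [N] from its position and velocity
    ([acceleration]); the resulting differential equation has solutions by
    Picard iteration ([picard_local]) and these stay in [N]
    ([level_geodesic_exists]). Since they are geodesics of the quadric too, the
    second fundamental form of [N] vanishes, which is a formula for the Hessian
    of [F] on vectors tangent to [N] ([totally_geodesic_hessian]).

    Let [b i] be the derivative of [F] along [n i], that is, the coordinates of
    the normal of [N] in the frame. The Hessian formula says that the derivative
    of [b] is parallel to [b], and differentiating the relation [dF t = 0] gives
    [\sum_i b i * kappa i = 0]. Hence the line spanned by [b] is constant. The
    equation [F] is only local, and neither the length nor the sign of [b] has a
    global meaning; the orthogonal projector on the line has one, as it can be
    computed from a normal field of [N] instead of [b]. Its entries have
    derivative zero on the whole interval ([local_normal_line]), and a nonzero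
    row of it is the required vector [a] ([hypersurface_curvatures]). *)

Set Implicit Arguments.
Unset Strict Implicit.
Unset Printing Implicit Defensive.

Import Order.TTheory GRing.Theory Num.Theory.
Import numFieldNormedType.Exports.

Local Open Scope classical_set_scope.
Local Open Scope ring_scope.

(** * Derivatives relative to a set *)

Section RelativeDerivative.
Variable R : realType.
Implicit Types (I J : set R) (s l k : R).

(** Contrary to the limit of quotients, this form also makes sense for [u = s],
    which spares composition a case distinction. *)
Lemma has_derivative_onP (V : normedModType R) I (f : R -> V) s (l : V) :
  has_derivative_on I f s l <->
  forall e, 0 < e -> exists2 d, 0 < d & forall u, I u -> `|u - s| < d ->
    `|f u - f s - (u - s) *: l| <= e * `|u - s|.
Proof.
have quotE u : u != s ->
    `|l - (u - s)^-1 *: (f u - f s)| * `|u - s| =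
    `|f u - f s - (u - s) *: l|.
  move=> us; have us0 : u - s != 0 by rewrite subr_eq0.
  rewrite mulrC -normrZ scalerBr scalerA divff// scale1r -normrN opprB.
  by [].
split=> [/cvgrPdist_le fl e e0|H].
  have [d /= d0 Hd] := fl _ e0.
  exists d => // u Iu us; have [->|uneqs] := eqVneq u s.
    by rewrite !subrr scale0r subr0 !normr0 mulr0.
  rewrite -quotE// ler_wpM2r//; apply: Hd => //=.
  by rewrite /ball /= distrC.
apply/cvgrPdist_le => /= e e0; have [d d0 Hd] := H _ e0.
exists d => //= u us uneqs Iu.
have u0 : 0 < `|u - s| by rewrite normr_gt0 subr_eq0.
by rewrite -(ler_pM2r u0) quotE// Hd// distrC.
Qed.

Lemma has_derivative_on_cvg (V : normedModType R) I (f : R -> V) s (l : V) :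
  has_derivative_on I f s l -> f u @[u --> within I s^'] --> f s.
Proof.
move/has_derivative_onP => H; apply/cvgrPdist_le => /= e e0.
have [d d0 Hd] := H 1 ltr01.
have K0 : 0 < 1 + `|l| by rewrite ltr_wpDr.
exists (Num.min d (e / (1 + `|l|))) => /=.
  by rewrite lt_min d0 divr_gt0.
move=> u /=; rewrite distrC lt_min => /andP[us use] _ Iu.
have := Hd u Iu us; rewrite mul1r => h.
rewrite distrC -[f u - f s](subrK ((u - s) *: l)).
rewrite (le_trans (ler_normD _ _))// normrZ.
move: use; rewrite ltr_pdivlMr// => use.
by rewrite (le_trans _ (ltW use))// mulrDr mulr1 lerD.
Qed.

(** Letting the set vary covers both the restriction to a smaller set and the
    passage from one-sided to two-sided derivatives. *)
Lemma has_derivative_on_near (V : normedModType R) I J (f g : R -> V) s (l : V) :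
  f s = g s -> (\forall u \near within I (nbhs s), f u = g u /\ J u) ->
  has_derivative_on J f s l -> has_derivative_on I g s l.
Proof.
move=> fgs [d /= d0 fg] /has_derivative_onP H; apply/has_derivative_onP => e e0.
have [d' d'0 Hd'] := H e e0.
exists (Num.min d d'); first by rewrite lt_min d0.
move=> u Iu; rewrite lt_min => /andP[ud ud'].
have [<- Ju] : f u = g u /\ J u by apply: fg => //; rewrite /ball /= distrC.
by rewrite -fgs Hd'.
Qed.

Lemma has_derivative_on_subset (V : normedModType R) I J (f : R -> V) s (l : V) :
  I `<=` J -> has_derivative_on J f s l -> has_derivative_on I f s l.
Proof.
by move=> IJ; apply: has_derivative_on_near => //; near=> u; split=> //;
  apply: IJ; near: u; exact: withinT.
Unshelve. all: by end_near. Qed.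

Lemma eq_has_derivative_on (V : normedModType R) I (f g : R -> V) s (l : V) :
  I s -> (forall u, I u -> f u = g u) ->
  has_derivative_on I f s l -> has_derivative_on I g s l.
Proof.
move=> Is fg; apply: has_derivative_on_near; first exact: fg.
apply: filterS (withinT _ _) => u Iu; split=> //; exact: fg.
Qed.

Lemma has_derivative_on_cst (V : normedModType R) I (c : V) s :
  has_derivative_on I (fun=> c) s 0.
Proof.
apply/has_derivative_onP => e e0; exists 1 => // u _ _.
by rewrite subrr scaler0 subr0 normr0 mulr_ge0// ltW.
Qed.

Lemma has_derivative_on_id I s : has_derivative_on I id s 1.
Proof.
apply/has_derivative_onP => e e0; exists 1 => // u _ _.
by rewrite scaler1 subrr normr0 mulr_ge0// ltW.
Qed.

Lemma has_derivative_onD (V : normedModType R) I (f g : R -> V) s (l k : V) :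
  has_derivative_on I f s l -> has_derivative_on I g s k ->
  has_derivative_on I (fun u => f u + g u) s (l + k).
Proof.
move=> fl gk; rewrite /has_derivative_on.
under eq_fun do rewrite opprD addrACA scalerDr.
exact: cvgD.
Qed.

Lemma has_derivative_on_sum (V : normedModType R) (n : nat) I
    (f : 'I_n -> R -> V) s (l : 'I_n -> V) :
  (forall i, has_derivative_on I (f i) s (l i)) ->
  has_derivative_on I (fun u => \sum_i f i u) s (\sum_i l i).
Proof.
elim: n f l => [|n IH] f l H.
  rewrite big_ord0; under [X in has_derivative_on _ X]eq_fun do rewrite big_ord0.
  exact: has_derivative_on_cst.
rewrite big_ord_recl.
under [X in has_derivative_on _ X]eq_fun do rewrite big_ord_recl.
by apply: has_derivative_onD => //; exact: IH.
Qed.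

Lemma has_derivative_onZ (V : normedModType R) I (f : R -> R) (g : R -> V) s
    l (k : V) :
  has_derivative_on I f s l -> has_derivative_on I g s k ->
  has_derivative_on I (fun u => f u *: g u) s (l *: g s + f s *: k).
Proof.
move=> fl gk; rewrite /has_derivative_on.
have E u : (u - s)^-1 *: (f u *: g u - f s *: g s) =
    ((u - s)^-1 *: (f u - f s)) *: g u + f s *: ((u - s)^-1 *: (g u - g s)).
  rewrite scalerA (mulrC (f s)) -scalerA -scalerA -scalerDr; congr (_ *: _).
  by rewrite scalerBl scalerBr addrA subrK.
under eq_fun do rewrite E.
apply: cvgD; first by apply: cvgZ => //; exact: has_derivative_on_cvg gk.
by apply: cvgZ => //; exact: cvg_cst.
Qed.

Lemma has_derivative_onM I (f g : R -> R) s l k :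
  has_derivative_on I f s l -> has_derivative_on I g s k ->
  has_derivative_on I (fun u => f u * g u) s (l * g s + f s * k).
Proof. exact: has_derivative_onZ. Qed.

Lemma has_derivative_onV I (f : R -> R) s l : f s != 0 ->
  has_derivative_on I f s l ->
  has_derivative_on I (fun u => (f u)^-1) s (- l / f s ^+ 2).
Proof.
move=> fs0 fl; have fc := has_derivative_on_cvg fl.
have H : - ((u - s)^-1 *: (f u - f s)) * ((f u)^-1 * (f s)^-1)
    @[u --> within I s^'] --> - l * ((f s)^-1 * (f s)^-1).
  apply: cvgM; first exact: cvgN.
  by apply: cvgM; [exact: cvgV | exact: cvg_cst].
rewrite /has_derivative_on expr2 invfM; apply: cvg_trans H; apply: near_eq_cvg.
have : \forall u \near within I s^', f u != 0.
  by move/cvgr_neq0: fc; apply.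
apply: filterS => u fu0; rewrite /GRing.scale/= -mulNr.
have -> : (f u)^-1 - (f s)^-1 = - (f u - f s) * ((f u)^-1 / f s).
  by field; rewrite fs0.
by rewrite !mulNr mulrN !mulrA.
Qed.

(** Points of [I] accumulate at each of its points as soon as [I] is a
    nondegenerate interval; this is what makes derivatives along [I] unique. *)
Lemma interval_limit_point I s d : is_interval I -> interior I !=set0 -> I s ->
  0 < d -> exists u, [/\ I u, u != s & `|u - s| < d].
Proof.
move=> itvI [x /= [e /= e0 xe]] Is d0.
have Ix : I x by apply: xe; rewrite /ball /= subrr normr0.
have [y [Iy ys]] : exists y, I y /\ y != s.
  have [xs|] := eqVneq x s; last by exists x.
  exists (x + e / 2); split.
    by apply: xe; rewrite /ball /= opprD addNKr normrN gtr0_norm; lra.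
  by rewrite xs; apply/eqP; lra.
have ys0 : 0 < `|y - s| by rewrite normr_gt0 subr_eq0.
(* Move from [s] towards [y] by a fraction small enough to stay at distance
   less than [d]. *)
pose q := Num.min (1/2) (d / (2 * `|y - s|)).
have q0 : 0 < q by rewrite lt_min !divr_gt0 ?mulr_gt0.
have q1 : q <= 1/2 by rewrite ge_min lexx.
have qd : q * `|y - s| < d.
  apply: (@le_lt_trans _ _ (d / 2)); last by lra.
  rewrite -ler_pdivlMr// (le_trans (_ : _ <= d / (2 * `|y - s|)))//.
    by rewrite ge_min lexx orbT.
  by rewrite invfM mulrA.
exists (s + q * (y - s)); split.
- have [sy|sy] := ltP s y.
    by apply: (itvI s y) => //; apply/andP; split; nra.
  by apply: (itvI y s) => //; apply/andP; split; nra.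
- by rewrite -subr_eq0 addrC addKr mulf_neq0 ?subr_eq0// gt_eqF.
- by rewrite addrC addKr normrM (gtr0_norm q0).
Qed.

Lemma has_derivative_on_unique (V : normedModType R) I (f : R -> V) s (l k : V) :
  (forall d, 0 < d -> exists u, [/\ I u, u != s & `|u - s| < d]) ->
  has_derivative_on I f s l -> has_derivative_on I f s k -> l = k.
Proof.
move=> acc /has_derivative_onP fl /has_derivative_onP fk.
apply/eqP; rewrite -subr_eq0 -normr_le0; apply/ler_addgt0Pl => e e0.
rewrite addr0; have e20 : 0 < e / 2 by rewrite divr_gt0.
have [d1 d10 H1] := fl _ e20; have [d2 d20 H2] := fk _ e20.
have [|u [Iu us]] := acc (Num.min d1 d2); first by rewrite lt_min d10.
rewrite lt_min => /andP[u1 u2].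
have us0 : 0 < `|u - s| by rewrite normr_gt0 subr_eq0.
rewrite -(ler_pM2l us0) -normrZ scalerBr.
have -> : (u - s) *: l - (u - s) *: k =
  (f u - f s - (u - s) *: k) - (f u - f s - (u - s) *: l).
  by rewrite [RHS]addrC opprB addrA subrK.
rewrite (le_trans (ler_normB _ _))// (le_trans (lerD (H2 _ _ _) (H1 _ _ _)))//.
by rewrite -mulrDl -splitr mulrC.
Qed.

Lemma has_derivative_on_coord (n : nat) I (f : R -> 'rV[R]_n) s
    (l : 'rV[R]_n) (i : 'I_n) :
  has_derivative_on I f s l -> has_derivative_on I (fun u => f u 0 i) s (l 0 i).
Proof.
move=> /has_derivative_onP H; apply/has_derivative_onP => e e0.
have [d d0 Hd] := H e e0; exists d => // u Iu us.
apply: le_trans (Hd u Iu us).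
rewrite [leRHS]/Num.Def.normr/= mx_normrE.
apply: le_trans; last exact: (le_bigmax _ _ (0, i)).
by rewrite !mxE.
Qed.

Lemma has_derivative_on_rowP (n : nat) I (f : R -> 'rV[R]_n) s (l : 'rV[R]_n) :
  has_derivative_on I f s l <->
  forall i, has_derivative_on I (fun u => f u 0 i) s (l 0 i).
Proof.
split=> [fl i|fl]; first exact: has_derivative_on_coord.
apply/cvgrPdist_le => /= e e0; near=> u.
rewrite /Num.Def.normr/= mx_normrE (bigmax_le _ (ltW e0))//= => -[i j] _.
rewrite !mxE/= ord1; move: j; near: u; apply: filter_forall => /= j.
by have /cvgrPdist_le := fl j; apply.
Unshelve. all: by end_near. Qed.

(** Directional derivatives are derivatives along a line, so that the calculus
    of relative derivatives applies to them. *)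
Lemma is_derive_dirP (V W : normedModType R) (f : V -> W) x v (l : W) :
  is_derive x v f l <-> has_derivative_on setT (fun h => f (h *: v + x)) (0 : R) l.
Proof.
have -> : has_derivative_on setT (fun h : R => f (h *: v + x)) (0 : R) l =
    (h^-1 *: (f (h *: v + x) - f x) @[h --> 0^'] --> l).
  rewrite /has_derivative_on withinET.
  by under eq_fun do rewrite subr0 scale0r add0r.
split=> [[fd <-]|fl]; first exact: fd.
by split; [apply/cvg_ex; exists l | apply/cvg_lim].
Qed.

Lemma is_derive1P (V : normedModType R) (f : R -> V) s (l : V) :
  is_derive s 1 f l <-> has_derivative_on setT f s l.
Proof.
rewrite is_derive_dirP !has_derivative_onP; split=> H e e0.
  have [d d0 Hd] := H e e0; exists d => // u _ us.
  have := Hd (u - s) I; rewrite subr0 scale0r add0r.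
  by rewrite [(u - s) *: 1]mulr1 subrK; exact.
have [d d0 Hd] := H e e0; exists d => // u _; rewrite subr0 => us.
have := Hd (u + s) I; rewrite addrK scale0r add0r.
by rewrite [u *: 1]mulr1; exact.
Qed.

Lemma is_derive1_on (V : normedModType R) I (f : R -> V) s (l : V) :
  is_derive s 1 f l -> has_derivative_on I f s l.
Proof. by move=> /is_derive1P; apply: has_derivative_on_subset. Qed.

Lemma has_derivative_on_is_derive (V : normedModType R) I (f : R -> V) s (l : V) :
  nbhs s I -> has_derivative_on I f s l -> is_derive s 1 f l.
Proof.
move=> sI fl; apply/is_derive1P; apply: has_derivative_on_near fl => //.
rewrite /within/=; apply: filterS sI => u Iu _; split=> //.
Qed.

Lemma setT_limit_point s d : 0 < d ->
  exists u, [/\ [set: R] u, u != s & `|u - s| < d].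
Proof.
move=> d0; exists (s + d / 2); split=> //; first by apply/eqP; lra.
by rewrite addrC addKr gtr0_norm; lra.
Qed.

Lemma is_derive_continuous (V : normedModType R) (f : R -> V) s (l : V) :
  is_derive s 1 f l -> {for s, continuous f}.
Proof. by move=> [/derivable1_diffP fd _]; exact: differentiable_continuous. Qed.

(** Inside [I] this is the mean value theorem; at an endpoint belonging to [I]
    the one-sided derivative still provides the continuity that it needs. *)
Lemma has_derivative_on0_cst I (f : R -> R) : is_interval I ->
  (forall s, I s -> has_derivative_on I f s 0) ->
  forall s u, I s -> I u -> f s = f u.
Proof.
move=> itvI f0; suff H s u : I s -> I u -> s < u -> f u = f s.
  move=> s u Is Iu; case: (ltgtP s u) => [su|us|->//].
    by rewrite (H s u).
  by rewrite (H u s).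
move=> Is Iu su.
have sub x : s <= x <= u -> I x by apply: itvI.
have [||c _] := @MVT _ f (fun=> 0) s u su; last first.
- by rewrite mul0r => /eqP; rewrite subr_eq0 => /eqP.
- apply/continuous_within_itvP => //; split.
  + move=> x; rewrite in_itv/= => /andP[sx xu].
    have Ix : nbhs x I.
      have : nbhs x `]s, u[%classic by apply: open_nbhs_nbhs; split;
        [exact: interval_open | rewrite /= in_itv/= sx].
      apply: filterS => y /=; rewrite in_itv/= => /andP[sy yu].
      by apply: sub; rewrite !ltW.
    have /f0/(has_derivative_on_is_derive Ix)[/derivable1_diffP fd _] : I x.
      by apply: sub; rewrite !ltW.
    exact: differentiable_continuous.
  + have sc := has_derivative_on_cvg (f0 s Is).
    apply: cvg_trans sc; apply: cvg_app => P [e /= e0 HP].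
    exists (Num.min e (u - s)); first by rewrite /= lt_min e0 subr_gt0.
    move=> x /=; rewrite lt_min => /andP[xe xu] sx.
    apply: HP => //; first by rewrite gt_eqF.
    apply: sub; rewrite ltW//=.
    by move: xu; rewrite distrC gtr0_norm ?subr_gt0// => ?; lra.
  + have sc := has_derivative_on_cvg (f0 u Iu).
    apply: cvg_trans sc; apply: cvg_app => P [e /= e0 HP].
    exists (Num.min e (u - s)); first by rewrite /= lt_min e0 subr_gt0.
    move=> x /=; rewrite lt_min => /andP[xe xu] ux.
    apply: HP => //; first by rewrite lt_eqF.
    apply: sub; rewrite andbC ltW//=.
    by move: xu; rewrite gtr0_norm ?subr_gt0// => ?; lra.
- move=> x; rewrite in_itv/= => /andP[sx xu].
  apply: (@has_derivative_on_is_derive _ I).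
    have : nbhs x `]s, u[%classic by apply: open_nbhs_nbhs; split;
      [exact: interval_open | rewrite /= in_itv/= sx].
    apply: filterS => y /=; rewrite in_itv/= => /andP[sy yu].
    by apply: sub; rewrite !ltW.
  by apply: f0; apply: sub; rewrite !ltW.
Qed.

(** The two orders of [0] and [a] are treated together, as directional
    increments have no preferred sign. *)
Lemma MVT_from0 (f df : R -> R) a :
  (forall s, (0 <= s <= a) || (a <= s <= 0) -> is_derive s 1 f (df s)) ->
  exists2 s, (0 <= s <= a) || (a <= s <= 0) & f a - f 0 = df s * a.
Proof.
move=> fd; have [a0|a0] := leP 0 a.
  have [||s] := @MVT_segment R f df 0 a a0.
  - move=> s; rewrite in_itv/= => /andP[s0 sa].
    by apply: fd; rewrite (ltW s0) (ltW sa).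
  - apply: derivable_within_continuous => s; rewrite in_itv/= => s0a.
    by apply: ex_derive; apply: fd; rewrite s0a.
  by rewrite in_itv/= subr0 => s0a H; exists s; rewrite ?s0a.
have [||s] := @MVT_segment R f df a 0 (ltW a0).
- move=> s; rewrite in_itv/= => /andP[s0 sa].
  by apply: fd; rewrite (ltW s0) (ltW sa) orbT.
- apply: derivable_within_continuous => s; rewrite in_itv/= => sa0.
  by apply: ex_derive; apply: fd; rewrite sa0 orbT.
rewrite in_itv/= => sa0 H; exists s; first by rewrite sa0 orbT.
by rewrite -opprB H sub0r mulrN opprK.
Qed.

End RelativeDerivative.

(** * The ambient form and its quadrics *)

Section AmbientForm.
Variables (R : realType) (m : nat) (g : space_form).
Implicit Types (x y z w : 'rV[R]_m.+2) (a : R) (I : set R).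
Local Notation form := (@ambient_form R m g).

(** Both forms are diagonal in the standard basis; keeping only the signs on
    the diagonal treats the two geometries at once. *)
Definition metric_sign (i : 'I_m.+2) : R :=
  match g with
  | Sphere => 1
  | Hyperbolic => if i == ord0 then -1 else 1
  end.

Lemma metric_signV i : metric_sign i * metric_sign i = 1.
Proof.
by rewrite /metric_sign; case: g; case: (i == ord0); rewrite ?mulr1// mulrNN mulr1.
Qed.

Lemma formE x y : form x y = \sum_i metric_sign i * (x 0 i * y 0 i).
Proof.
rewrite /ambient_form /metric_sign; case: g.
  by apply: eq_bigr => i _; rewrite mul1r.
rewrite [RHS]big_ord_recl eqxx mulN1r; congr (_ + _).
by apply: eq_bigr => i _; rewrite mul1r.
Qed.

Lemma formC x y : form x y = form y x.
Proof. by rewrite !formE; apply: eq_bigr => i _; rewrite [x _ _ * _]mulrC. Qed.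

Lemma formDl x y z : form (x + y) z = form x z + form y z.
Proof.
by rewrite !formE -big_split/=; apply: eq_bigr => i _; rewrite mxE mulrDl mulrDr.
Qed.

Lemma formZl a x y : form (a *: x) y = a * form x y.
Proof.
rewrite !formE mulr_sumr; apply: eq_bigr => i _.
by rewrite mxE -mulrA mulrCA.
Qed.

Lemma form0l x : form 0 x = 0.
Proof. by rewrite -(scale0r x) formZl mul0r. Qed.

Lemma formNl x y : form (- x) y = - form x y.
Proof. by rewrite -scaleN1r formZl mulN1r. Qed.

Lemma formBl x y z : form (x - y) z = form x z - form y z.
Proof. by rewrite formDl formNl. Qed.

Lemma formDr x y z : form x (y + z) = form x y + form x z.
Proof. by rewrite formC formDl !(formC _ x). Qed.

Lemma formZr a x y : form x (a *: y) = a * form x y.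
Proof. by rewrite formC formZl formC. Qed.

Lemma form0r x : form x 0 = 0.
Proof. by rewrite formC form0l. Qed.

Lemma formNr x y : form x (- y) = - form x y.
Proof. by rewrite formC formNl formC. Qed.

Lemma formBr x y z : form x (y - z) = form x y - form x z.
Proof. by rewrite formDr formNr. Qed.

Lemma form_suml (k : nat) (f : 'I_k -> 'rV[R]_m.+2) y :
  form (\sum_i f i) y = \sum_i form (f i) y.
Proof.
elim/big_rec2: _ => [|i a b _ <-]; first exact: form0l.
by rewrite formDl.
Qed.

Lemma form_sumr (k : nat) (f : 'I_k -> 'rV[R]_m.+2) y :
  form y (\sum_i f i) = \sum_i form y (f i).
Proof. by rewrite formC form_suml; apply: eq_bigr => i _; rewrite formC. Qed.

Lemma form_delta x i : form x (delta_mx 0 i) = metric_sign i * x 0 i.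
Proof.
rewrite formE (bigD1 i)//= big1 ?addr0 => [|j /negPf ji].
  by rewrite mxE !eqxx mulr1.
by rewrite mxE ji andbF !mulr0.
Qed.

Lemma form_nondegenerate x : (forall y, form x y = 0) -> x = 0.
Proof.
move=> x0; apply/rowP => i; rewrite mxE.
have := x0 (delta_mx 0 i); rewrite form_delta => /(congr1 ( *%R (metric_sign i))).
by rewrite mulrA metric_signV mul1r mulr0.
Qed.

(** An orthogonal family of non-isotropic vectors, as many as the dimension,
    spans: its Gram matrix is diagonal and invertible. *)
Lemma form_orthogonal_span (E : 'I_m.+2 -> 'rV[R]_m.+2) (d : 'I_m.+2 -> R) x :
  (forall i j, form (E i) (E j) = if i == j then d i else 0) ->
  (forall i, d i != 0) ->
  (forall i, form x (E i) = 0) -> x = 0.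
Proof.
move=> EE d0 xE; pose B := \matrix_i E i.
pose S : 'M[R]_m.+2 := diag_mx (\row_i metric_sign i).
have SE (k : nat) (A C : 'M[R]_(k, m.+2)) i j :
    (A *m S *m C^T) i j = form (row i A) (row j C).
  rewrite formE mxE; apply: eq_bigr => l _.
  by rewrite /S mul_mx_diag !mxE [_ * metric_sign l]mulrC mulrA.
have BU : B \in unitmx.
  have : B *m S *m B^T = diag_mx (\row_i d i).
    apply/matrixP => i j; rewrite SE !rowK EE !mxE.
    by case: eqP => [->|]; rewrite ?mulr1n ?mulr0n.
  move/(congr1 (fun A => \det A)); rewrite !det_mulmx !det_diag.
  move=> /eqP; rewrite unitmxE unitfE; apply: contraTneq => ->.
  rewrite !mul0r eq_sym; apply/prodf_neq0 => i _; rewrite mxE; exact: d0.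
apply: form_nondegenerate => y.
have -> : y = \sum_i (y *m invmx B) 0 i *: E i.
  rewrite -{1}(mulmxKV BU y) mulmx_sum_row; apply: eq_bigr => i _.
  by rewrite rowK.
by rewrite form_sumr big1// => i _; rewrite formZr xE mulr0.
Qed.

(** A vector normal to the quadric and a tangent frame make an orthogonal basis. *)
Lemma frame_span (p t : 'rV[R]_m.+2) (n : 'I_m -> 'rV[R]_m.+2) x :
  form p p != 0 -> form p t = 0 -> (forall i, form p (n i) = 0) ->
  form t t = 1 -> (forall i, form t (n i) = 0) ->
  (forall i j, form (n i) (n j) = (i == j)%:R) ->
  form x p = 0 -> form x t = 0 -> (forall i, form x (n i) = 0) -> x = 0.
Proof.
move=> pp pt pn tt tn nn xp xt xn.
pose E i := if unlift ord0 i is Some j then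
  if unlift ord0 j is Some k then n k else t else p.
pose d (i : 'I_m.+2) := if i == ord0 then form p p else 1.
apply: (@form_orthogonal_span E d) => [i j|i|i].
- rewrite /E /d; case: (unliftP ord0 i) => [i' ->|->];
    case: (unliftP ord0 j) => [j' ->|->]; rewrite ?eqxx//.
  + rewrite (inj_eq lift_inj); case: (unliftP ord0 i') => [i2 ->|->];
      case: (unliftP ord0 j') => [j2 ->|->]; rewrite ?eqxx//=.
    * by rewrite (inj_eq lift_inj) nn; case: eqP.
    * by rewrite formC tn.
  + by rewrite formC; case: (unliftP ord0 i').
  + by case: (unliftP ord0 j').
- by rewrite /d; case: ifP => // _; exact: oner_neq0.
- rewrite /E; case: (unliftP ord0 i) => [j _|_//].
  by case: (unliftP ord0 j).
Qed.

Lemma has_derivative_on_form I (f h : R -> 'rV[R]_m.+2) s l k :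
  has_derivative_on I f s l -> has_derivative_on I h s k ->
  has_derivative_on I (fun u => form (f u) (h u)) s (form l (h s) + form (f s) k).
Proof.
move=> fl hk; rewrite !formE -big_split/=.
under [X in has_derivative_on _ X]eq_fun do rewrite formE.
apply: has_derivative_on_sum => i.
rewrite -mulrDr -[X in has_derivative_on _ _ _ X]add0r.
rewrite -[X in has_derivative_on _ _ _ (X + _)](mul0r (f s 0 i * h s 0 i)).
apply: has_derivative_onM; first exact: has_derivative_on_cst.
by apply: has_derivative_onM; exact: has_derivative_on_coord.
Qed.

End AmbientForm.

Arguments has_derivative_on_form {R m} g {I f h s l k}.

Section Quadric.
Variables (R : realType) (m : nat) (g : space_form) (r : R).
Hypothesis r_gt0 : 0 < r.
Implicit Types (p q v w : 'rV[R]_m.+2).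
Local Notation form := (@ambient_form R m g).
Local Notation M := (@ambient_space R m g r).

Definition quadric_level : R :=
  match g with Sphere => r ^+ 2 | Hyperbolic => - r ^+ 2 end.

Lemma quadric_level_neq0 : quadric_level != 0.
Proof. by rewrite /quadric_level; case: g; rewrite ?oppr_eq0 expf_neq0// gt_eqF. Qed.

Lemma ambient_space_form q : M q -> form q q = quadric_level.
Proof. by rewrite /quadric_level; case: g => //= -[]. Qed.

Lemma tangent_form p v : tangent M p v -> form p v = 0.
Proof.
move=> [c [c0 /is_derive1P cv Mc]].
have H := has_derivative_on_form g cv cv.
have : has_derivative_on setT (fun u => form (c u) (c u)) 0 0.
  apply: has_derivative_on_near (has_derivative_on_cst setT quadric_level 0).
    by rewrite (ambient_space_form (nbhs_singleton Mc)).
  by rewrite withinET; apply: filterS Mc => u Mu; rewrite (ambient_space_form Mu).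
move/(has_derivative_on_unique (@setT_limit_point R 0) H).
by rewrite c0 (formC _ v) -mulr2n -mulr_natl => /eqP; rewrite mulf_eq0 pnatr_eq0 => /eqP.
Qed.

(** A tangent vector has to be realized by a curve. The section of the quadric
    by the plane of [p] and [v] is a conic, and its stereographic
    parametrization is rational, for the sphere and the hyperboloid alike. *)
Lemma section_tangent w p v : M p -> form w p = 0 ->
  form p v = 0 -> form w v = 0 ->
  tangent [set x | M x /\ form w x = 0] p v.
Proof.
move=> Mp wp pv wv; have pp := ambient_space_form Mp.
have e0 := quadric_level_neq0; set e := quadric_level in pp e0.
(* The value of [k] for which [c u] below has square [e]. *)
pose k := form v v / (4 * e).
pose D u : R := 1 + k * (u * u).
have dD : has_derivative_on setT D 0 0.
  have := has_derivative_onD (has_derivative_on_cst setT (1 : R) 0)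
    (has_derivative_onM (has_derivative_on_cst setT k 0)
    (has_derivative_onM (has_derivative_on_id setT 0) (has_derivative_on_id setT 0))).
  by rewrite !(mul0r, mulr0, addr0).
pose c u := (2 / D u - 1) *: p + (u / D u) *: v.
have D0 : D 0 = 1 by rewrite /D !mulr0 addr0.
have dDV : has_derivative_on setT (fun u => (D u)^-1) 0 0.
  have := has_derivative_onV _ dD; rewrite D0 oppr0 mul0r; apply.
  exact: oner_neq0.
have c0 : c 0 = p.
  by rewrite /c D0 mul0r scale0r addr0 divr1 (_ : 2 - 1 = 1) ?scale1r//; lra.
have dc : is_derive (0 : R) 1 c v.
  apply/is_derive1P.
  have H := has_derivative_onD
    (has_derivative_onZ (has_derivative_onD (has_derivative_onM
       (has_derivative_on_cst setT (2 : R) 0) dDV)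
       (has_derivative_on_cst setT (- 1 : R) 0)) (has_derivative_on_cst setT p 0))
    (has_derivative_onZ (has_derivative_onM (has_derivative_on_id setT 0) dDV)
       (has_derivative_on_cst setT v 0)).
  move: H; rewrite D0 invr1 !(mul0r, mulr0, addr0, mulr1, scaler0, add0r, scale0r).
  by rewrite scale1r.
exists c; split=> //.
have cc := is_derive_continuous dc.
have DN0 : \forall u \near (0 : R), D u != 0.
  have /(is_derive_continuous) : is_derive (0 : R) 1 D 0 by apply/is_derive1P.
  by move/cvgr_neq0; apply; rewrite D0 oner_neq0.
have cform : \forall u \near (0 : R), form (c u) (c u) = e.
  apply: filterS DN0 => u Du.
  rewrite /c !(formDl, formDr, formZl, formZr) (formC _ v) pp pv !mulr0 addr0 add0r.
  have -> : form v v = 4 * e * k by rewrite /k; field; rewrite e0.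
  by move: Du; rewrite /D => Du; field; rewrite Du.
have cw u : form w (c u) = 0 by rewrite /c formDr !formZr wp wv !mulr0 addr0.
suff : \forall u \near (0 : R), M (c u) by apply: filterS => u Mu; split.
move: Mp cform; rewrite /e /quadric_level.
case: (g) => [_|[_ p0]] cform; first exact: cform.
have c00 : \forall u \near (0 : R), 0 < c u 0 0.
  have /is_derive_continuous cc0 : is_derive (0 : R) 1 (fun u => c u 0 0) (v 0 0).
    by apply/is_derive1P; apply: has_derivative_on_coord; apply/is_derive1P.
  by move/cvgr_gt: cc0; apply; rewrite c0.
by apply: filterS2 cform c00.
Qed.

End Quadric.

(** * Partial derivatives of functions of several variables *)

Section RowNorm.
Variables (R : realType) (n : nat).
Implicit Types (v : 'rV[R]_n) (e : R).

Lemma ler_coord_norm v i : `|v 0 i| <= `|v|.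
Proof.
rewrite [leRHS]/Num.Def.normr/= mx_normrE.
exact: (le_bigmax _ (fun ij => `|v ij.1 ij.2|) (0, i)).
Qed.

Lemma row_norm_le v e : 0 <= e -> (forall i, `|v 0 i| <= e) -> `|v| <= e.
Proof.
move=> e0 ve; rewrite /Num.Def.normr/= mx_normrE (bigmax_le _ e0)//= => -[i j] _.
by rewrite /= ord1.
Qed.

Lemma row_norm_lt v e : 0 < e -> (forall i, `|v 0 i| < e) -> `|v| < e.
Proof.
move=> e0 ve; rewrite /Num.Def.normr/= mx_normrE.
by apply: bigmax_lt => //= -[i j] _; rewrite /= ord1.
Qed.

End RowNorm.

Lemma nbhs_distP (R : realType) (V : normedModType R) (x : V) (P : set V) :
  nbhs x P <-> exists2 d, 0 < d & forall u, `|u - x| < d -> P u.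
Proof.
split=> [/nbhs_normP[d /= d0 H]|[d d0 H]].
  by exists d => // u ux; apply: H; rewrite /ball_/= distrC.
by apply/nbhs_normP; exists d => //= u; rewrite /= distrC; exact: H.
Qed.

Section Partials.
Variables (R : realType) (n : nat).
Implicit Types (F : 'rV[R]_n.+1 -> R) (x y z v w : 'rV[R]_n.+1)
  (U : set 'rV[R]_n.+1) (I : set R).

Definition partial F i x : R := 'D_(delta_mx 0 i) F x.

Definition differential F x v : R := \sum_i partial F i x * v 0 i.

Lemma is_derive_line F h v s : derivable F (s *: v + h) v ->
  is_derive s 1 (fun u : R => F (u *: v + h)) ('D_v F (s *: v + h)).
Proof.
move=> /derivableP/is_derive_dirP/has_derivative_onP H.
apply/is_derive1P/has_derivative_onP => e e0.
have [d d0 Hd] := H e e0; exists d => // u _ us.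
have := Hd (u - s) I; rewrite subr0 scale0r add0r => /(_ us).
by rewrite addrA -scalerDl subrK.
Qed.

Lemma line_MVT F h v a :
  (forall s, (0 <= s <= a) || (a <= s <= 0) -> derivable F (s *: v + h) v) ->
  exists2 s, (0 <= s <= a) || (a <= s <= 0) &
    F (a *: v + h) - F h = 'D_v F (s *: v + h) * a.
Proof.
move=> dF; have [|s sa H] := @MVT_from0 R (fun u => F (u *: v + h))
    (fun s => 'D_v F (s *: v + h)) a.
  by move=> s sa; apply: is_derive_line; exact: dF.
by exists s => //; rewrite -H scale0r add0r.
Qed.

(** The segment from [z] to [y] is replaced by a path parallel to the axes,
    whose vertices are the rows [h k] below. *)
Lemma partial_MVT F x d y z :
  (forall u, `|u - x| < d -> forall i, derivable F u (delta_mx 0 i)) ->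
  `|y - x| < d -> `|z - x| < d ->
  exists2 xi : 'I_n.+1 -> 'rV[R]_n.+1, (forall i, `|xi i - x| < d) &
    F y - F z = \sum_i partial F i (xi i) * (y - z) 0 i.
Proof.
move=> dF yx zx; have d0 : 0 < d by apply: le_lt_trans yx.
pose h (k : nat) : 'rV[R]_n.+1 := \row_j (if (j < k)%N then y 0 j else z 0 j).
have hS (i : 'I_n.+1) : h i.+1 = (y - z) 0 i *: delta_mx 0 i + h i.
  apply/rowP => j; rewrite !mxE eqxx/= ltnS.
  have [->|ji] := eqVneq j i; first by rewrite leqnn ltnn mulr1 subrK.
  by rewrite mulr0 add0r leq_eqVlt (negPf (ji : (j : nat) != i)).
have H (i : 'I_n.+1) : exists2 xi, `|xi - x| < d &
    F (h i.+1) - F (h i) = partial F i xi * (y - z) 0 i.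
  have inb s : (0 <= s <= (y - z) 0 i) || ((y - z) 0 i <= s <= 0) ->
      `|s *: delta_mx 0 i + h i - x| < d.
    move=> sb; apply: row_norm_lt => // j; rewrite !mxE eqxx/=.
    have yj := le_lt_trans (ler_coord_norm (y - x) j) yx.
    have zj := le_lt_trans (ler_coord_norm (z - x) j) zx.
    move: sb yj zj; rewrite !mxE.
    have [->|ji] := eqVneq j i; last first.
      by rewrite mulr0 add0r; case: ifP.
    rewrite ltnn mulr1 !ltr_norml.
    by move=> /orP[/andP[a b]|/andP[a b]] /andP[? ?] /andP[? ?];
      apply/andP; split; lra.
  have [|s sb Fs] := @line_MVT F (h i) (delta_mx 0 i) ((y - z) 0 i).
    by move=> s sb; apply: dF; exact: inb.
  by exists (s *: delta_mx 0 i + h i); [exact: inb | rewrite hS Fs].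
pose xi i := s2val (cid2 (H i)).
exists xi; first by move=> i; exact: s2valP (cid2 (H i)).
have -> : F y - F z = \sum_(i < n.+1) (F (h i.+1) - F (h i)).
  rewrite -(big_mkord xpredT (fun i => F (h i.+1) - F (h i))) telescope_sumr//.
  by congr (F _ - F _); apply/rowP => j; rewrite mxE// ltn_ord.
by apply: eq_bigr => i _; exact: s2valP' (cid2 (H i)).
Qed.

Lemma differentialD F x v w :
  differential F x (v + w) = differential F x v + differential F x w.
Proof.
by rewrite /differential -big_split; apply: eq_bigr => i _; rewrite mxE mulrDr.
Qed.

Lemma differentialZ F x a v : differential F x (a *: v) = a * differential F x v.
Proof.
by rewrite /differential mulr_sumr; apply: eq_bigr => i _; rewrite mxE mulrCA.
Qed.

Lemma differential_sum k F x (c : 'I_k -> R) (v : 'I_k -> 'rV[R]_n.+1) :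
  differential F x (\sum_i c i *: v i) = \sum_i c i * differential F x (v i).
Proof.
elim/big_rec2: _ => [|i y z _ <-]; last by rewrite differentialD differentialZ.
by rewrite /differential big1// => i _; rewrite mxE mulr0.
Qed.

Lemma differential_delta F x i : differential F x (delta_mx 0 i) = partial F i x.
Proof.
rewrite /differential (bigD1 i)//= big1 ?addr0 => [|j /negPf ji].
  by rewrite mxE !eqxx mulr1.
by rewrite mxE ji andbF mulr0.
Qed.

(** The classical sufficient condition for differentiability at a point. *)
Definition C1_at F x :=
  (\forall u \near x, forall i, derivable F u (delta_mx 0 i)) /\
  forall i, {for x, continuous (partial F i)}.

(** By [partial_MVT] the remainder involves only the oscillation of the partial
    derivatives near [x]. *)
Lemma C1_frechet F x : C1_at F x -> forall e, 0 < e ->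
  exists2 d, 0 < d & forall y, `|y - x| < d ->
    `|F y - F x - differential F x (y - x)| <= e * `|y - x|.
Proof.
move=> [dF cF] e e0; pose e' := e / n.+1%:R.
have e'0 : 0 < e' by rewrite divr_gt0.
have cF' : \forall u \near x, forall i, `|partial F i x - partial F i u| <= e'.
  apply: (@filter_forall _ _ _ _ (nbhs_filter x)) => i.
  by have /cvgrPdist_le := cF i; apply.
have /nbhs_distP[d d0 Hd] : nbhs x [set u |
    (forall i, derivable F u (delta_mx 0 i)) /\
    forall i, `|partial F i x - partial F i u| <= e'] by exact: filterI.
exists d => // y yx.
have xx : `|x - x| < d by rewrite subrr normr0.
have [xi xid ->] := partial_MVT (fun u ux => (Hd u ux).1) yx xx.
rewrite /differential -sumrB.
apply: le_trans (ler_norm_sum _ _ _) _.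
apply: (@le_trans _ _ (\sum_(i < n.+1) e' * `|y - x|)).
  apply: ler_sum => i _; rewrite -mulrBl normrM.
  apply: ler_pM => //; last exact: ler_coord_norm.
  by rewrite distrC; have [_ /(_ i)] := Hd _ (xid i).
rewrite sumr_const card_ord -[X in X <= _]mulr_natl mulrA.
by rewrite /e' mulrCA mulfV ?mulr1// pnatr_eq0.
Qed.

Lemma has_derivative_on_comp F I (c : R -> 'rV[R]_n.+1) s l :
  C1_at F (c s) -> has_derivative_on I c s l ->
  has_derivative_on I (F \o c) s (differential F (c s) l).
Proof.
move=> /C1_frechet HF /has_derivative_onP Hc; apply/has_derivative_onP => e e0.
pose K := 1 + `|l|; have K0 : 0 < K by rewrite ltr_wpDr.
pose N := 1 + \sum_i `|partial F i (c s)|.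
have N0 : 0 < N by rewrite ltr_wpDr// sumr_ge0.
have [d1 d10 H1] := HF (e / 2 / K) (divr_gt0 (divr_gt0 e0 (ltr0Sn R 1)) K0).
pose e2 := Num.min 1 (e / 2 / N).
have e20 : 0 < e2 by rewrite lt_min ltr01 !divr_gt0.
have [d2 d20 H2] := Hc e2 e20.
have dn v : `|differential F (c s) v| <= N * `|v|.
  apply: le_trans (ler_norm_sum _ _ _) _.
  rewrite mulrDl mul1r mulr_suml -[leLHS]add0r lerD//.
  apply: ler_sum => i _; rewrite normrM ler_wpM2l//; exact: ler_coord_norm.
exists (Num.min d2 (d1 / K)); first by rewrite lt_min d20 divr_gt0.
move=> u Iu; rewrite lt_min => /andP[ud2 ud1].
have Hu := H2 u Iu ud2.
have cu : `|c u - c s| <= K * `|u - s|.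
  rewrite -[c u - c s](subrK ((u - s) *: l)) (le_trans (ler_normD _ _))//.
  rewrite normrZ /K mulrDl mul1r [`|l| * _]mulrC lerD//.
  rewrite (le_trans Hu)// -[leRHS]mul1r ler_wpM2r//.
  by rewrite /e2 ge_min lexx.
have cud : `|c u - c s| < d1.
  by apply: le_lt_trans cu _; rewrite mulrC -ltr_pdivlMr.
have HFu := H1 _ cud.
have -> : (F \o c) u - (F \o c) s - (u - s) *: differential F (c s) l =
   (F (c u) - F (c s) - differential F (c s) (c u - c s)) +
   differential F (c s) (c u - c s - (u - s) *: l).
  have -> : differential F (c s) (c u - c s - (u - s) *: l) =
      differential F (c s) (c u - c s) - (u - s) * differential F (c s) l.
    by rewrite -scaleNr [LHS]differentialD differentialZ mulNr.
  by rewrite /GRing.scale/= subrKA.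
rewrite (le_trans (ler_normD _ _))// [leRHS](_ : _ =
   e / 2 / K * (K * `|u - s|) + N * (e / 2 / N * `|u - s|)); last first.
  by field; rewrite !gt_eqF.
apply: lerD; first by rewrite (le_trans HFu)// ler_wpM2l// ltW// !divr_gt0.
rewrite (le_trans (dn _))// ler_wpM2l ?(ltW N0)// (le_trans Hu)// ler_wpM2r//.
by rewrite /e2 ge_min lexx orbT.
Qed.

Lemma derive_differential F x v : C1_at F x -> 'D_v F x = differential F x v.
Proof.
move=> HF; have H : has_derivative_on setT (fun h : R => h *: v + x) (0 : R) v.
  have := has_derivative_onD (has_derivative_onZ (has_derivative_on_id setT 0)
    (has_derivative_on_cst setT v 0)) (has_derivative_on_cst setT x 0).
  by rewrite scale1r scaler0 !addr0.
have x0 : (0 : R) *: v + x = x by rewrite scale0r add0r.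
have /is_derive_dirP := @has_derivative_on_comp F _ _ _ _ (eq_ind_r _ HF x0) H.
by rewrite x0 => ?; apply: derive_val.
Qed.

Lemma Ck_on_C1_at k U F x : open U -> U x -> Ck_on k.+1 U F -> C1_at F x.
Proof.
move=> Uo Ux [cF H]; split=> [|i].
  have : nbhs x U by apply: open_nbhs_nbhs.
  by apply: filterS => u Uu i; have [+ _] := H i; exact.
by have [_] := H i; case: k H => [|k] _ [+ _]; exact.
Qed.

Lemma Ck_on_partial k U F i : Ck_on k.+1 U F -> Ck_on k U (partial F i).
Proof. by case=> _ /(_ i)[]. Qed.

Lemma is_derive_translate F a x v : derivable F (x + a) v ->
  is_derive x v (fun u => F (u + a)) ('D_v F (x + a)).
Proof.
move=> /derivableP/is_derive_dirP H; apply/is_derive_dirP.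
by under [X in has_derivative_on _ X]eq_fun do rewrite -addrA.
Qed.

Definition second_difference F x v w (h : R) :=
  F (h *: v + x + h *: w) - F (h *: v + x) - (F (x + h *: w) - F x).

Lemma second_differenceC F x v w h :
  second_difference F x v w h = second_difference F x w v h.
Proof.
rewrite /second_difference [h *: v + x]addrC [h *: w + x]addrC [x + _ + _]addrAC.
have E (a b c d : R) : a - b - (c - d) = a - c - (b - d) by ring.
exact: E.
Qed.

(** The mean value theorem in the direction [i] turns the second difference
    into an increment of [partial F i], which is differentiable at [x]. *)
Lemma second_difference_cvg U F x i j : open U -> U x -> Ck_on 2 U F ->
  forall e, 0 < e -> exists2 d, 0 < d & forall h, 0 < h -> h < d ->
    `|second_difference F x (delta_mx 0 i) (delta_mx 0 j) h -
      h ^+ 2 * partial (partial F i) j x| <= e * h ^+ 2.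
Proof.
move=> Uo Ux F2 e e0; set v := delta_mx 0 i; set w := delta_mx 0 j.
have C1 := Ck_on_C1_at Uo Ux (Ck_on_partial i F2).
have [d1 d10 H1] := C1_frechet C1 (divr_gt0 e0 (ltr0Sn R 2)).
have /nbhs_distP[d2 d20 H2] : nbhs x U by apply: open_nbhs_nbhs.
pose d := Num.min d1 d2.
have d0 : 0 < d by rewrite lt_min d10.
have v1 : `|v| <= 1.
  apply: row_norm_le => // k; rewrite !mxE eqxx/=.
  by case: eqP => _; rewrite ?normr1 ?normr0.
have w1 : `|w| <= 1.
  apply: row_norm_le => // k; rewrite !mxE eqxx/=.
  by case: eqP => _; rewrite ?normr1 ?normr0.
exists (d / 2); first by rewrite divr_gt0.
move=> h h0 hd.
have vn s : 0 <= s <= h -> `|s *: v| <= h.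
  move=> /andP[s0 sh]; rewrite normrZ ger0_norm// (le_trans _ sh)//.
  by rewrite ler_piMr.
have wn : `|h *: w| <= h by rewrite normrZ gtr0_norm// ler_piMr// ltW.
have in1 s : 0 <= s <= h -> `|s *: v + x - x| < d.
  by move=> /vn sh; rewrite addrK (le_lt_trans sh)//; lra.
have in2 s : 0 <= s <= h -> `|s *: v + x + h *: w - x| < d.
  move=> /vn sh; rewrite addrAC addrK (le_lt_trans (ler_normD _ _))//.
  by rewrite (le_lt_trans (lerD sh wn))//; lra.
have dF u : `|u - x| < d -> derivable F u v.
  move=> ux; have [_ /(_ i)[H _]] := F2; apply/H/H2.
  by rewrite (lt_le_trans ux)// /d ge_min lexx orbT.
pose G u := F (u + h *: w) - F u.
have dG s : 0 <= s <= h -> is_derive (s *: v + x) v G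
    (partial F i (s *: v + x + h *: w) - partial F i (s *: v + x)).
  move=> sh; apply: is_deriveB; first by apply/is_derive_translate/dF/in2.
  by apply/derivableP/dF/in1.
have [s sb|s sb] := @line_MVT G x v h.
  have sh : 0 <= s <= h.
    by case/orP: sb => // /andP[? ?]; apply/andP; split; lra.
  by have [] := dG s sh.
have sh : 0 <= s <= h.
  by case/orP: sb => // /andP[? ?]; apply/andP; split; lra.
rewrite {1}/G {1}/G -/(second_difference F x v w h) => ->.
have [_ ->] := dG s sh.
have b1 := H1 _ (lt_le_trans (in1 s sh) _).
have b2 := H1 _ (lt_le_trans (in2 s sh) _).
have {}b1 := b1 (ltac:(by rewrite ge_min lexx)).
have {}b2 := b2 (ltac:(by rewrite ge_min lexx)).
have : `|s *: v + x - x| <= h by rewrite addrK vn.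
have : `|s *: v + x + h *: w - x| <= h + h.
  by rewrite addrAC addrK (le_trans (ler_normD _ _))// lerD// vn.
move: b1 b2; set A := partial F i (s *: v + x); set B := partial F i (_ + h *: w).
rewrite addrK [s *: v + x + _ - x]addrAC addrK differentialD !differentialZ.
rewrite !differential_delta; set P := partial (partial F i) i x.
set Q := partial (partial F i) j x.
set n1 := `|s *: v|; set n2 := `|s *: v + h *: w| => b1 b2 n2h n1h.
have -> : (B - A) * h - h ^+ 2 * Q =
   ((B - partial F i x - (s * P + h * Q)) - (A - partial F i x - s * P)) * h.
  by ring.
rewrite normrM (gtr0_norm h0) expr2 mulrA ler_wpM2r ?(ltW h0)//.
rewrite (le_trans (ler_normB _ _))// (le_trans (lerD b2 b1))//.
by rewrite -mulrDr -mulrA ler_wpM2l ?(ltW e0)//; lra.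
Qed.

(** Both mixed partials are the limit of the same symmetric second difference
    quotient. *)
Lemma partialC U F x i j : open U -> U x -> Ck_on 2 U F ->
  partial (partial F i) j x = partial (partial F j) i x.
Proof.
move=> Uo Ux F2; apply/eqP; rewrite -subr_eq0 -normr_le0.
apply/ler_addgt0Pl => e e0; rewrite addr0.
have e20 : 0 < e / 2 by rewrite divr_gt0.
have [d1 d10 H1] := second_difference_cvg i j Uo Ux F2 e20.
have [d2 d20 H2] := second_difference_cvg j i Uo Ux F2 e20.
pose h := Num.min d1 d2 / 2.
have d0 : 0 < Num.min d1 d2 by rewrite lt_min d10.
have h0 : 0 < h by rewrite divr_gt0.
have hd : h < Num.min d1 d2 by rewrite /h; lra.
move: (hd); rewrite lt_min => /andP[hd1 hd2].
have := H1 h h0 hd1; have := H2 h h0 hd2; rewrite second_differenceC.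
set S := second_difference _ _ _ _ _ => b2 b1.
have h20 : 0 < h ^+ 2 by rewrite exprn_gt0.
rewrite -(ler_pM2l h20) -{1}(gtr0_norm h20) -normrM mulrBr.
have E (a b c : R) : a - b = c - b - (c - a) by ring.
rewrite (E _ _ S).
rewrite (le_trans (ler_normB _ _))// (le_trans (lerD b2 b1))//.
by rewrite -mulrDl -splitr mulrC.
Qed.

Definition hessian F x v w : R :=
  \sum_i differential (partial F i) x w * v 0 i.

Lemma hessianC U F x v w : open U -> U x -> Ck_on 2 U F ->
  hessian F x v w = hessian F x w v.
Proof.
move=> Uo Ux F2; rewrite /hessian /differential.
under eq_bigr do rewrite mulr_suml.
rewrite exchange_big; apply: eq_bigr => i _; rewrite mulr_suml.
by apply: eq_bigr => j _; rewrite (partialC _ _ Uo Ux F2) mulrAC.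
Qed.

Lemma hessianDl F x v1 v2 w :
  hessian F x (v1 + v2) w = hessian F x v1 w + hessian F x v2 w.
Proof.
by rewrite /hessian -big_split; apply: eq_bigr => i _; rewrite mxE mulrDr.
Qed.

Lemma hessianDr F x v w1 w2 :
  hessian F x v (w1 + w2) = hessian F x v w1 + hessian F x v w2.
Proof.
rewrite /hessian -big_split; apply: eq_bigr => i _.
by rewrite differentialD mulrDl.
Qed.

Lemma hessianZl F x a v w : hessian F x (a *: v) w = a * hessian F x v w.
Proof.
by rewrite /hessian mulr_sumr; apply: eq_bigr => i _; rewrite mxE mulrCA.
Qed.

Lemma hessian_suml k F x (c : 'I_k -> R) (v : 'I_k -> 'rV[R]_n.+1) w :
  hessian F x (\sum_i c i *: v i) w = \sum_i c i * hessian F x (v i) w.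
Proof.
elim/big_rec2: _ => [|i y z _ <-]; last by rewrite hessianDl hessianZl.
by rewrite /hessian big1// => i _; rewrite mxE mulr0.
Qed.

Lemma has_derivative_on_differential F I (c v : R -> 'rV[R]_n.+1) s l k :
  (forall i, C1_at (partial F i) (c s)) ->
  has_derivative_on I c s l -> has_derivative_on I v s k ->
  has_derivative_on I (fun u => differential F (c u) (v u)) s
    (hessian F (c s) (v s) l + differential F (c s) k).
Proof.
move=> HF cl vk; rewrite /hessian /differential -big_split.
apply: has_derivative_on_sum => i; apply: has_derivative_onM.
  exact: has_derivative_on_comp.
exact: has_derivative_on_coord.
Qed.

End Partials.

(** * Existence of solutions of ordinary differential equations *)

Definition lipschitz_near (R : realType) (V W : normedModType R) (f : V -> W)
    (z : V) :=
  exists L d : R, [/\ 0 <= L, 0 < d & forall x y,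
    `|x - z| < d -> `|y - z| < d -> `|f x - f y| <= L * `|x - y|].

Section LocallyLipschitz.
Variables (R : realType) (n : nat).
Implicit Types (f h : 'rV[R]_n -> R) (x y z : 'rV[R]_n).

Lemma lipschitz_near_cst (a : R) z : lipschitz_near (fun=> a) z.
Proof.
by exists 0, 1; split=> // x y _ _; rewrite subrr normr0 mul0r.
Qed.

Lemma lipschitz_near_coord i z : lipschitz_near (fun x => x 0 i) z.
Proof.
exists 1, 1; split=> // x y _ _; rewrite mul1r.
by apply: le_trans (ler_coord_norm _ i); rewrite !mxE.
Qed.

Lemma lipschitz_nearD f h z : lipschitz_near f z -> lipschitz_near h z ->
  lipschitz_near (fun x => f x + h x) z.
Proof.
move=> [L1 [d1 [L10 d10 H1]]] [L2 [d2 [L20 d20 H2]]].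
exists (L1 + L2), (Num.min d1 d2).
split=> [||x y]; rewrite ?lt_min ?d10 ?addr_ge0//.
move=> /andP[x1 x2] /andP[y1 y2].
rewrite opprD addrACA (le_trans (ler_normD _ _))// mulrDl lerD//.
  exact: H1.
exact: H2.
Qed.

Lemma lipschitz_nearN f z : lipschitz_near f z -> lipschitz_near (fun x => - f x) z.
Proof.
move=> [L1 [d1 [L10 d10 H1]]]; exists L1, d1; split=> // x y x1 y1.
by rewrite -opprD normrN; exact: H1.
Qed.

Lemma lipschitz_near_sum k (f : 'I_k -> 'rV[R]_n -> R) z :
  (forall i, lipschitz_near (f i) z) ->
  lipschitz_near (fun x => \sum_i f i x) z.
Proof.
elim: k f => [|k IH] f H.
  under [X in lipschitz_near X]eq_fun do rewrite big_ord0.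
  exact: lipschitz_near_cst.
under [X in lipschitz_near X]eq_fun do rewrite big_ord_recl.
by apply: lipschitz_nearD => //; exact: IH.
Qed.

Lemma lipschitz_near_bounded f z : lipschitz_near f z -> exists K d : R,
  [/\ 0 < K, 0 < d & forall x, `|x - z| < d -> `|f x| <= K].
Proof.
move=> [L [d [L0 d0 H]]]; exists (L * d + `|f z| + 1), d; split=> // [|x xz].
  by rewrite ltr_wpDl// addr_ge0// mulr_ge0// ltW.
rewrite -[f x](subrK (f z)) (le_trans (ler_normD _ _))//.
rewrite -addrA lerD//; last by rewrite lerDl.
rewrite (le_trans (H x z xz _))//; first by rewrite subrr normr0.
by rewrite ler_wpM2l// ltW.
Qed.

Lemma lipschitz_nearM f h z : lipschitz_near f z -> lipschitz_near h z ->
  lipschitz_near (fun x => f x * h x) z.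
Proof.
move=> Hf Hh.
have [K1 [d3 [K10 d30 B1]]] := lipschitz_near_bounded Hf.
have [K2 [d4 [K20 d40 B2]]] := lipschitz_near_bounded Hh.
move: Hf Hh => [L1 [d1 [L10 d10 H1]]] [L2 [d2 [L20 d20 H2]]].
exists (K1 * L2 + K2 * L1), (Num.min (Num.min d1 d2) (Num.min d3 d4)).
split=> [||x y]; first by rewrite addr_ge0 ?mulr_ge0// ltW.
  by rewrite !lt_min d10 d20 d30.
rewrite !lt_min => /andP[/andP[x1 x2] /andP[x3 x4]] /andP[/andP[y1 y2] /andP[y3 y4]].
have -> : f x * h x - f y * h y = f x * (h x - h y) + h y * (f x - f y) by ring.
rewrite (le_trans (ler_normD _ _))// !normrM mulrDl -!mulrA lerD//.
  by apply: ler_pM => //; [exact: B1 | exact: H2].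
by apply: ler_pM => //; [exact: B2 | exact: H1].
Qed.

Lemma lipschitz_nearV f z : f z != 0 -> lipschitz_near f z ->
  lipschitz_near (fun x => (f x)^-1) z.
Proof.
move=> fz0 [L [d [L0 d0 H]]]; set a := `|f z| / 2.
have a0 : 0 < a by rewrite divr_gt0// normr_gt0.
have La : 0 < L + 1 by rewrite ltr_wpDl.
have low x : `|x - z| < Num.min d (a / (L + 1)) -> a <= `|f x|.
  rewrite lt_min => /andP[xd]; rewrite ltr_pdivlMr// => xa.
  have := H x z xd _; rewrite subrr normr0 => /(_ d0) b.
  have c : `|f x - f z| <= a.
    rewrite (le_trans b)// (le_trans _ (ltW xa))// mulrC ler_wpM2l//.
    by rewrite lerDl.
  have := ler_normD (f z - f x) (f x); rewrite subrK distrC.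
  by move: c; rewrite /a; lra.
exists (L / (a * a)), (Num.min d (a / (L + 1))); split.
- by rewrite mulr_ge0// invr_ge0 mulr_ge0// ltW.
- by rewrite lt_min d0 divr_gt0.
move=> x y xz yz; have fx := low x xz; have fy := low y yz.
move: xz yz; rewrite !lt_min => /andP[xz _] /andP[yz _].
have fx0 : 0 < `|f x| by apply: lt_le_trans fx.
have fy0 : 0 < `|f y| by apply: lt_le_trans fy.
have -> : (f x)^-1 - (f y)^-1 = - (f x - f y) / (f x * f y).
  by field; rewrite -!normr_gt0 fx0 fy0.
rewrite normrM normrN normfV normrM mulrAC.
rewrite [leRHS]mulrAC [L / _ * _]mulrAC.
apply: ler_pM => //; first exact: H.
have aa : a * a <= `|f x| * `|f y| by apply: ler_pM => //; exact: ltW.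
by rewrite lef_pV2// posrE mulr_gt0.
Qed.

End LocallyLipschitz.

Lemma lipschitz_near_cvg (R : realType) (V W : normedModType R) (f : V -> W) z :
  lipschitz_near f z -> exists2 d : R, 0 < d &
  forall (T : Type) (F : set_system T) (FF : Filter F) (phi : T -> V) x,
    `|x - z| < d -> phi u @[u --> F] --> x -> f (phi u) @[u --> F] --> f x.
Proof.
move=> [L [d [L0 d0 H]]]; exists d => // T F FF phi x xz /cvgrPdist_lt phix.
apply/cvgrPdist_le => /= e e0.
have L1 : 0 < L + 1 by rewrite ltr_wpDl.
have r0 : 0 < Num.min (d - `|x - z|) (e / (L + 1)).
  by rewrite lt_min subr_gt0 xz divr_gt0.
apply: filterS (phix _ r0) => u; rewrite lt_min => /andP[u1 u2].
rewrite (le_trans (H _ _ xz _))//.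
  rewrite -[phi u - z](subrKA x) (le_lt_trans (ler_normD _ _))//.
  by rewrite -ltrBrDr distrC.
move: u2; rewrite ltr_pdivlMr// => u2.
by rewrite (le_trans _ (ltW u2))// mulrC ler_wpM2l// lerDl ler01.
Qed.


Lemma lipschitz_near_comp (R : realType) (V' V W : normedModType R)
    (phi : V' -> V) (f : V -> W) z :
  (forall x y, `|phi x - phi y| <= `|x - y|) ->
  lipschitz_near f (phi z) -> lipschitz_near (f \o phi) z.
Proof.
move=> Hphi [L [d [L0 d0 H]]]; exists L, d; split=> // x y xz yz.
rewrite (le_trans (H _ _ _ _))//.
- exact: le_lt_trans xz.
- exact: le_lt_trans yz.
by rewrite ler_wpM2l.
Qed.

Lemma C1_lipschitz_near (R : realType) (n : nat) (F : 'rV[R]_n.+1 -> R) x :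
  C1_at F x -> lipschitz_near F x.
Proof.
move=> [dF cF].
have cF' : \forall u \near x, forall i, `|partial F i x - partial F i u| <= 1.
  apply: (@filter_forall _ _ _ _ (nbhs_filter x)) => i.
  by have /cvgrPdist_le := cF i; apply.
have /nbhs_distP[d d0 Hd] : nbhs x [set u |
    (forall i, derivable F u (delta_mx 0 i)) /\
    forall i, `|partial F i x - partial F i u| <= 1] by exact: filterI.
exists (\sum_i (`|partial F i x| + 1)), d; split=> //.
  by apply: sumr_ge0 => i _; rewrite addr_ge0.
move=> y z yx zx.
have [xi xid ->] := partial_MVT (fun u ux => (Hd u ux).1) yx zx.
rewrite (le_trans (ler_norm_sum _ _ _))// mulr_suml ler_sum// => i _.
rewrite normrM ler_pM//; last exact: ler_coord_norm.
have [_ /(_ i) b] := Hd _ (xid i).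
rewrite -[partial F i (xi i)](subrK (partial F i x)) addrC.
by rewrite (le_trans (ler_normD _ _))// lerD// distrC.
Qed.

Lemma lipschitz_near_row (R : realType) (V : normedModType R) (n : nat)
    (f : V -> 'rV[R]_n) z :
  (forall i, lipschitz_near (fun x => f x 0 i) z) -> lipschitz_near f z.
Proof.
move=> Hf; pose L i := projT1 (cid (Hf i)); pose d i := projT1 (cid (projT2 (cid (Hf i)))).
have H i : [/\ 0 <= L i, 0 < d i & forall x y, `|x - z| < d i ->
    `|y - z| < d i -> `|f x 0 i - f y 0 i| <= L i * `|x - y|].
  exact: (projT2 (cid (projT2 (cid (Hf i))))).
have L0 i : 0 <= L i by case: (H i).
exists (\sum_i L i), (\big[Num.min/1]_i d i); split.
- exact: sumr_ge0.
- by apply: lt_bigmin => // i _; case: (H i).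
move=> x y xz yz; apply: row_norm_le; first by rewrite mulr_ge0 ?sumr_ge0.
move=> i; rewrite !mxE; have [_ _ Hi] := H i.
rewrite (le_trans (Hi x y _ _))//.
- by rewrite (lt_le_trans xz)// bigmin_le.
- by rewrite (lt_le_trans yz)// bigmin_le.
by rewrite ler_wpM2r// (bigD1 i)//= lerDl sumr_ge0.
Qed.

Section Picard.
Variable R : realType.

(** The sequences [u k - 2 * C / 2 ^+ k] and [u k + 2 * C / 2 ^+ k] are
    respectively nondecreasing and nonincreasing, and they squeeze the limit. *)
Lemma geometric_cvg (u : nat -> R) (C : R) : 0 <= C ->
  (forall k, `|u k.+1 - u k| <= C / 2 ^+ k) ->
  exists l, forall k, `|u k - l| <= 2 * C / 2 ^+ k.
Proof.
move=> C0 uC; pose e k := 2 * C / 2 ^+ k.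
have eS k : e k = 2 * e k.+1 by rewrite /e exprS; field; rewrite expf_neq0.
have e0 k : 0 <= e k by rewrite !mulr_ge0// invr_ge0 exprn_ge0.
have uC' k : `|u k.+1 - u k| <= e k.+1.
  rewrite (le_trans (uC k))// /e exprS le_eqVlt; apply/orP; left; apply/eqP.
  by field; rewrite expf_neq0.
have lo k j : u k - e k <= u (k + j)%N - e (k + j)%N.
  elim: j => [|j IH]; first by rewrite addn0.
  rewrite (le_trans IH)// addnS; have := uC' (k + j)%N.
  by rewrite ler_norml [e (k + j)%N]eS => /andP[]; lra.
have hi k j : u (k + j)%N + e (k + j)%N <= u k + e k.
  elim: j => [|j IH]; first by rewrite addn0.
  rewrite (le_trans _ IH)// addnS; have := uC' (k + j)%N.
  by rewrite ler_norml [e (k + j)%N]eS => /andP[]; lra.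
have lohi k j : u k - e k <= u j + e j.
  have [kj|/ltnW jk] := leqP k j.
    rewrite -(subnKC kj) (le_trans (lo k (j - k)%N))//.
    by rewrite lerD2l; have := e0 (k + (j - k))%N; lra.
  rewrite -(subnKC jk) (le_trans _ (hi j (k - j)%N))//.
  by rewrite lerD2l; have := e0 (j + (k - j))%N; lra.
pose A := range (fun k => u k - e k).
have A0 : A !=set0 by exists (u 0%N - e 0%N), 0%N.
have Aub : has_ubound A by exists (u 0%N + e 0%N) => _ [k _ <-].
exists (sup A) => k; rewrite ler_norml -/(e k).
have a1 : u k - e k <= sup A by apply: ub_le_sup => //; exists k.
have a2 : sup A <= u k + e k by apply: ge_sup => // _ [j _ <-].
by apply/andP; split; lra.
Qed.

(** The fundamental theorem of calculus differentiates an integral strictly to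
    the right of its lower bound; starting from [-1] makes [0] an interior point. *)
Definition primitive (f : R -> R) (x : R) : R :=
  (\int[@lebesgue_measure R]_(t in [set` `[- 1, x]]) (f t))%R -
  (\int[@lebesgue_measure R]_(t in [set` `[- 1, 0]]) (f t))%R.

Lemma is_derive_primitive (f : R -> R) (s : R) : continuous f -> `|s| < 1 ->
  is_derive s 1 (primitive f) (f s).
Proof.
move=> cf; rewrite ltr_norml => /andP[s1 s2].
have [dF Fs] := @continuous_FTC1_closed R f (-1) s 1 s2
  (continuous_compact_integrable (@segment_compact _ _ _)
     (continuous_subspaceT cf)) s1 (cf s).
rewrite -[f s]subr0; apply: is_deriveB.
by rewrite -Fs derive1E; exact: derivableP.
Qed.

Lemma primitive0 f : primitive f 0 = 0.
Proof. exact: subrr. Qed.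

Lemma derive_bound (f df : R -> R) (d K s : R) :
  (forall u : R, `|u| <= d -> is_derive u 1 f (df u)) ->
  (forall u, `|u| <= d -> `|df u| <= K) -> `|s| <= d ->
  `|f s - f 0| <= K * `|s|.
Proof.
move=> fd dfK sd.
have H u : (0 <= u <= s) || (s <= u <= 0) -> `|u| <= d.
  move=> us; apply: le_trans sd.
  case/orP: us => /andP[a b]; first by rewrite !ger0_norm// (le_trans a).
  by rewrite !ler0_norm ?lerN2// (le_trans a b).
have [|u us ->] := @MVT_from0 R f df s; first by move=> u /H/fd.
by rewrite normrM ler_wpM2r// dfK// H.
Qed.

Definition clamp (d s : R) : R := Num.max (- d) (Num.min d s).

Lemma clamp_norm d s : 0 <= d -> `|clamp d s| <= d.
Proof.
move=> d0; rewrite /clamp ler_norml le_max lexx/= ge_max ge_min lexx/=.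
by rewrite andbT; lra.
Qed.

Lemma clamp_id d s : `|s| <= d -> clamp d s = s.
Proof. by rewrite ler_norml => /andP[a b]; rewrite /clamp min_r// max_r. Qed.

Lemma clamp_lipschitz d s u : `|clamp d s - clamp d u| <= `|s - u|.
Proof.
have max_lip (a x y : R) : `|Num.max a x - Num.max a y| <= `|x - y|.
  have [ax|xa] := leP a x; have [ay|ya] := leP a y => //.
  - by rewrite !ger0_norm; lra.
  - by rewrite !ler0_norm; lra.
  - by rewrite subrr normr0.
have min_lip (a x y : R) : `|Num.min a x - Num.min a y| <= `|x - y|.
  have [ax|xa] := leP a x; have [ay|ya] := leP a y => //.
  - by rewrite subrr normr0.
  - by rewrite !ger0_norm; lra.
  - by rewrite !ler0_norm; lra.
by rewrite (le_trans (max_lip _ _ _)).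
Qed.

Lemma cvg_rowP (T : Type) (F : set_system T) (FF : Filter F) (n : nat)
    (f : T -> 'rV[R]_n) (l : 'rV[R]_n) :
  (forall i, f u 0 i @[u --> F] --> l 0 i) -> f u @[u --> F] --> l.
Proof.
move=> fl; apply/cvgrPdist_le => /= e e0; near=> u.
apply: row_norm_le (ltW e0) _ => i; rewrite !mxE.
move: i; near: u; apply: filter_forall => /= j.
by have /cvgrPdist_le := fl j; apply.
Unshelve. all: by end_near. Qed.

Section Iteration.
Variables (n : nat) (f : 'rV[R]_n -> 'rV[R]_n) (z0 : 'rV[R]_n) (L : R).
Hypotheses (L_ge0 : 0 <= L)
  (f_lip : forall x y, `|f x - f y| <= L * `|x - y|).

(** Small enough for a step to halve distances, and for [-d, d] to stay inside
    the interval where [primitive] is differentiable. *)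
Let d : R := (2 * (L + 1))^-1.

Let d_gt0 : 0 < d.
Proof. by rewrite invr_gt0 mulr_gt0// ltr_wpDl. Qed.

Let d_lt1 : d < 1.
Proof.
have h : 1 < 2 * (L + 1) by move: L_ge0; lra.
by rewrite /d invf_lt1// (lt_trans ltr01).
Qed.

Let Ld_half : L * d <= 1 / 2.
Proof.
rewrite /d invfM mulrA -mulrA mulrCA mulrC ler_wpM2r//.
by rewrite ler_pdivrMr ?ltr_wpDl// mul1r lerDl.
Qed.

(** Clamping the time keeps every iterate continuous on the whole line. *)
Definition picard_step (y : R -> 'rV[R]_n) (s : R) : 'rV[R]_n :=
  \row_i (z0 0 i + primitive (fun u => f (y u) 0 i) (clamp d s)).

Let f_coord_continuous (y : R -> 'rV[R]_n) i :
  (forall s, y u @[u --> s] --> y s) -> continuous (fun u => f (y u) 0 i).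
Proof.
move=> cy s; apply/cvgrPdist_le => /= e e0.
have L1 : 0 < L + 1 by rewrite ltr_wpDl.
have /cvgrPdist_lt/(_ (e / (L + 1))) := cy s; rewrite divr_gt0// => /(_ isT).
apply: filterS => u us; have := ler_coord_norm (f (y s) - f (y u)) i.
rewrite !mxE => /le_trans; apply; rewrite (le_trans (f_lip _ _))//.
move: us; rewrite ltr_pdivlMr// => us.
by rewrite (le_trans _ (ltW us))// mulrC ler_wpM2l// lerDl.
Qed.

Lemma picard_step_continuous (y : R -> 'rV[R]_n) :
  (forall s, y u @[u --> s] --> y s) ->
  forall s, picard_step y u @[u --> s] --> picard_step y s.
Proof.
move=> cy s; apply: cvg_rowP => i; rewrite /picard_step mxE.
under eq_fun do rewrite mxE.
apply: cvgD; first exact: cvg_cst.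
have cc : {for s, continuous (clamp d)}.
  apply/cvgrPdist_le => /= e e0; exists e => // u /= us.
  by rewrite (le_trans (clamp_lipschitz _ _ _))// ltW.
apply: (continuous_comp cc); apply: is_derive_continuous.
apply: is_derive_primitive; first exact: f_coord_continuous.
by rewrite (le_lt_trans _ d_lt1)// clamp_norm// ltW.
Qed.

Lemma picard_step_bound (y1 y2 : R -> 'rV[R]_n) C s :
  (forall s, y1 u @[u --> s] --> y1 s) -> (forall s, y2 u @[u --> s] --> y2 s) ->
  0 <= C -> (forall s, `|y1 s - y2 s| <= C) ->
  `|picard_step y1 s - picard_step y2 s| <= C / 2.
Proof.
move=> c1 c2 C0 y12; apply: row_norm_le; first by rewrite divr_ge0.
move=> i; rewrite !mxE opprD addrACA subrr add0r.
have cs : `|clamp d s| <= d by rewrite clamp_norm// ltW.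
pose G u := primitive (fun u => f (y1 u) 0 i) u - primitive (fun u => f (y2 u) 0 i) u.
have G0 : G 0 = 0 by rewrite /G !primitive0 subrr.
have : `|G (clamp d s) - G 0| <= L * C * `|clamp d s|.
  apply: (@derive_bound G (fun u => f (y1 u) 0 i - f (y2 u) 0 i) d) => // u ud.
    have u1 := le_lt_trans ud d_lt1.
    by apply: is_deriveB; apply: is_derive_primitive => //; exact: f_coord_continuous.
  have := ler_coord_norm (f (y1 u) - f (y2 u)) i.
  rewrite !mxE => /le_trans; apply; rewrite (le_trans (f_lip _ _))//.
  by rewrite ler_wpM2l.
rewrite G0 subr0 => /le_trans; apply.
rewrite (le_trans (ler_wpM2l _ cs)) ?mulr_ge0// mulrAC mulrC ler_wpM2l//.
by rewrite (le_trans Ld_half)// div1r.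
Qed.

Let y_ k := iter k picard_step (fun=> z0).

Let y_continuous k s : y_ k u @[u --> s] --> y_ k s.
Proof.
elim: k s => [|k IH] s /=; first exact: cvg_cst.
exact: picard_step_continuous.
Qed.

Let C0 : R := `|f z0|.

Let C0_ge0 : 0 <= C0. Proof. exact: normr_ge0. Qed.

Let y1_bound s : `|picard_step (fun=> z0) s - z0| <= C0.
Proof.
apply: row_norm_le => // i; rewrite !mxE addrAC subrr add0r.
have cs : `|clamp d s| <= d by rewrite clamp_norm// ltW.
have : `|primitive (fun=> f z0 0 i) (clamp d s) - primitive (fun=> f z0 0 i) 0|
    <= C0 * `|clamp d s|.
  apply: (@derive_bound _ (fun=> f z0 0 i) d) => // u ud; last exact: ler_coord_norm.
  apply: is_derive_primitive; last exact: le_lt_trans ud d_lt1.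
  by apply: (@f_coord_continuous (fun=> z0)) => s'; exact: cvg_cst.
by rewrite primitive0 subr0 => /le_trans; apply; rewrite ler_piMr// (le_trans cs)// ltW.
Qed.

Let yS_bound k s : `|y_ k.+1 s - y_ k s| <= C0 / 2 ^+ k.
Proof.
elim: k s => [|k IH] s; first by rewrite expr0 divr1; exact: y1_bound.
rewrite exprSr invfM mulrA [_ / _ / _]mulrAC mulrAC.
apply: (@picard_step_bound (y_ k.+1) (y_ k)); last exact: IH.
- exact: (@y_continuous k.+1).
- exact: (@y_continuous k).
by rewrite divr_ge0.
Qed.

Let coord_limit s i : exists l, forall k, `|y_ k s 0 i - l| <= 2 * C0 / 2 ^+ k.
Proof.
apply: geometric_cvg => // k; apply: le_trans (yS_bound k s).
by have := ler_coord_norm (y_ k.+1 s - y_ k s) i; rewrite !mxE.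
Qed.

Let y s : 'rV[R]_n := \row_i projT1 (cid (coord_limit s i)).

Let y_near k s : `|y_ k s - y s| <= 2 * C0 / 2 ^+ k.
Proof.
apply: row_norm_le; first by rewrite divr_ge0// mulr_ge0.
by move=> i; rewrite !mxE; exact: (projT2 (cid (coord_limit s i)) k).
Qed.

Let small (a e : R) : 0 < e -> 0 <= a -> exists k, a / 2 ^+ k < e.
Proof.
move=> e0 a0; have [k ak] : exists k : nat, a / e < k%:R.
  by exists (Num.truncn (a / e)).+1; rewrite truncnS_gt.
exists k; rewrite ltr_pdivrMr ?exprn_gt0// mulrC -ltr_pdivrMr//.
by rewrite (lt_trans ak)// -natrX ltr_nat ltn_expl.
Qed.

Let y_cont s : y u @[u --> s] --> y s.
Proof.
apply/cvgrPdist_le => /= e e0; have e3 : 0 < e / 3 by rewrite divr_gt0.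
have [|k ke] := @small (2 * C0) _ e3; first by rewrite mulr_ge0.
have /cvgrPdist_lt/(_ _ e3) := @y_continuous k s.
apply: filterS => u us.
rewrite -(subrKA (y_ k s)) -[y_ k s - y u](subrKA (y_ k u)).
rewrite (le_trans (ler_normD _ _))//.
rewrite (le_trans (lerD (lexx _) (ler_normD _ _)))// distrC.
by have := y_near k s; have := y_near k u; lra.
Qed.

Let y_fix s : picard_step y s = y s.
Proof.
apply/eqP; rewrite -subr_eq0 -normr_le0; apply/ler_addgt0Pl => e e0; rewrite addr0.
have [|k ke] := @small (4 * C0) _ e0; first by rewrite mulr_ge0.
have b : 0 <= 2 * C0 / 2 ^+ k by rewrite divr_ge0// mulr_ge0.
have H : `|picard_step (y_ k) s - picard_step y s| <= 2 * C0 / 2 ^+ k / 2.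
  by apply: picard_step_bound b (y_near k); [exact: (@y_continuous k)|exact: (@y_cont)].
have H' := y_near k.+1 s.
rewrite -(subrKA (y_ k.+1 s)) (le_trans (ler_normD _ _))//.
rewrite distrC (le_trans (lerD H H'))// (le_trans _ (ltW ke))//.
rewrite exprS; set p := 2 ^+ k; have p0 : 0 < p by rewrite exprn_gt0.
have -> : 2 * C0 / p / 2 + 2 * C0 / (2 * p) = 2 * (C0 / p).
  by field; rewrite gt_eqF.
by rewrite -mulrA ler_wpM2r ?ler_nat// divr_ge0// ltW.
Qed.

Lemma picard_global : exists2 e : R, 0 < e &
  exists z : R -> 'rV[R]_n, z 0 = z0 /\
    forall s : R, `|s| < e -> is_derive s 1 z (f (z s)).
Proof.
exists d; first exact: d_gt0.
exists y; split.
  apply/rowP => i; rewrite -y_fix mxE clamp_id ?normr0 ?ltW//.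
  by rewrite primitive0 addr0.
move=> s sd; apply/is_derive1P/has_derivative_on_rowP => i; apply/is_derive1P.
have H : is_derive s 1 (fun u => z0 0 i + primitive (fun u => f (y u) 0 i) u) (f (y s) 0 i).
  rewrite -[f (y s) 0 i]add0r; apply: is_deriveD.
  apply: is_derive_primitive; last exact: lt_trans sd d_lt1.
  exact: f_coord_continuous.
move/is_derive1P: H => H; apply/is_derive1P.
apply: has_derivative_on_near H; first by rewrite -[in RHS]y_fix mxE clamp_id// ltW.
rewrite withinET; apply/nbhs_distP; exists (d - `|s|); first by rewrite subr_gt0.
move=> u us; split => //; rewrite -y_fix mxE clamp_id//.
rewrite -(subrK s u) (le_trans (ler_normD _ _))//.
by rewrite -lerBrDr ltW.
Qed.

End Iteration.

(** Truncating the argument to a cube around the initial value makes the vector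
    field globally Lipschitz without changing it near that value. *)
Lemma picard_local (n : nat) (f : 'rV[R]_n -> 'rV[R]_n) (z0 : 'rV[R]_n) :
  (forall i, lipschitz_near (fun x => f x 0 i) z0) ->
  exists2 e : R, 0 < e & exists z : R -> 'rV[R]_n, z 0 = z0 /\
    forall s : R, `|s| < e -> is_derive s 1 z (f (z s)).
Proof.
move=> /lipschitz_near_row[L [d [L0 d0 H]]].
have d20 : 0 < d / 2 by rewrite divr_gt0.
pose phi (x : 'rV[R]_n) := \row_i (z0 0 i + clamp (d / 2) (x 0 i - z0 0 i)).
have phi_near x : `|phi x - z0| < d.
  apply: (@le_lt_trans _ _ (d / 2)); last by lra.
  apply: row_norm_le => [|i]; first exact: ltW.
  by rewrite !mxE addrAC subrr add0r clamp_norm// ltW.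
have phi_lip x y : `|phi x - phi y| <= `|x - y|.
  apply: row_norm_le => // i; rewrite !mxE opprD addrACA subrr add0r.
  rewrite (le_trans (clamp_lipschitz _ _ _))//.
  have -> : x 0 i - z0 0 i - (y 0 i - z0 0 i) = x 0 i - y 0 i by ring.
  by have := ler_coord_norm (x - y) i; rewrite !mxE.
have phi_id x : `|x - z0| <= d / 2 -> phi x = x.
  move=> xz; apply/rowP => i; rewrite mxE clamp_id; first by rewrite addrC subrK.
  by have := ler_coord_norm (x - z0) i; rewrite !mxE => /le_trans; apply.
have f_lip x y : `|(f \o phi) x - (f \o phi) y| <= L * `|x - y|.
  by rewrite (le_trans (H _ _ _ _))// ler_wpM2l.
have [e e0 [z [zz0 dz]]] := picard_global z0 L0 f_lip.
have z_cont : z u @[u --> (0 : R)] --> z0.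
  by rewrite -zz0; apply: is_derive_continuous (dz 0 _); rewrite normr0.
have /nbhs_distP[e' e'0 He'] : \forall u \near (0 : R), `|z u - z0| <= d / 2.
  by move/cvgrPdist_le: z_cont => /(_ _ d20); apply: filterS => u; rewrite distrC.
exists (Num.min e e'); first by rewrite lt_min e0.
exists z; split=> // s; rewrite lt_min => /andP[se se'].
by have := dz s se; rewrite /= phi_id// He'// subr0.
Qed.

End Picard.

(** * Geodesics of a hypersurface given by an equation *)

Section LipschitzRow.
Variables (R : realType) (k n : nat).
Implicit Types (a b : 'rV[R]_k -> 'rV[R]_n) (z : 'rV[R]_k).

Definition row_lipschitz_near a z := forall i, lipschitz_near (fun x => a x 0 i) z.

Lemma row_lipschitz_nearD a b z : row_lipschitz_near a z ->
  row_lipschitz_near b z -> row_lipschitz_near (fun x => a x + b x) z.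
Proof.
move=> az bz i; under [X in lipschitz_near X]eq_fun do rewrite mxE.
exact: lipschitz_nearD.
Qed.

Lemma row_lipschitz_nearZ (f : 'rV[R]_k -> R) b z : lipschitz_near f z ->
  row_lipschitz_near b z -> row_lipschitz_near (fun x => f x *: b x) z.
Proof.
move=> fz bz i; under [X in lipschitz_near X]eq_fun do rewrite mxE.
exact: lipschitz_nearM.
Qed.

Lemma row_lipschitz_nearN b z :
  row_lipschitz_near b z -> row_lipschitz_near (fun x => - b x) z.
Proof.
move=> bz i; under [X in lipschitz_near X]eq_fun do rewrite mxE.
exact: lipschitz_nearN.
Qed.

End LipschitzRow.

Lemma form_lipschitz_near (R : realType) (m k : nat) (g : space_form)
    (a b : 'rV[R]_k -> 'rV[R]_m.+2) z :
  row_lipschitz_near a z -> row_lipschitz_near b z ->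
  lipschitz_near (fun x => ambient_form g (a x) (b x)) z.
Proof.
move=> az bz; under [X in lipschitz_near X]eq_fun do rewrite formE.
apply: lipschitz_near_sum => i; apply: lipschitz_nearM.
  exact: lipschitz_near_cst.
exact: lipschitz_nearM.
Qed.

Section Geodesics.
Variables (R : realType) (m : nat) (g : space_form) (r : R).
Hypothesis r_gt0 : 0 < r.
Local Notation form := (@ambient_form R m g).
Local Notation M := (@ambient_space R m g r).
Implicit Types (p q x y v w : 'rV[R]_m.+2).

Lemma tangentP p v : M p -> tangent M p v <-> form p v = 0.
Proof.
move=> Mp; split; first exact: tangent_form.
move=> pv; have [||c [c0 dc Mc]] := @section_tangent R m g r r_gt0 0 p v Mp _ pv.
- by rewrite form0l.
- by rewrite form0l.
by exists c; split=> //; apply: filterS Mc => u [].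
Qed.

(** A level set [F = 0] of the quadric is the local model of a hypersurface.
    The acceleration below is the one forced on a curve of velocity [y] at [x]
    by the two constraints, when it has no component along the level set. *)
Section LevelSet.
Variable F : 'rV[R]_m.+2 -> R.

Definition gradient x : 'rV[R]_m.+2 := \row_i (metric_sign R g i * partial F i x).

Lemma form_gradient x v : form (gradient x) v = differential F x v.
Proof.
rewrite formE; apply: eq_bigr => i _.
by rewrite mxE !mulrA metric_signV mul1r.
Qed.

Definition level_normal x := gradient x - (differential F x x / form x x) *: x.

Lemma form_normal x v : form x v = 0 -> form (level_normal x) v = differential F x v.
Proof. by move=> xv; rewrite formBl formZl xv mulr0 subr0 form_gradient. Qed.

Lemma form_normal_self x : form x x != 0 -> form (level_normal x) x = 0.
Proof. by move=> xx; rewrite formBl formZl form_gradient divfK// subrr. Qed.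

Lemma differential_normal x : form x x != 0 ->
  differential F x (level_normal x) = form (level_normal x) (level_normal x).
Proof. by move=> xx; rewrite form_normal// formC form_normal_self. Qed.

Definition quadric_curvature x y := - form y y / form x x.

Definition level_curvature x y :=
  - (hessian F x y y + quadric_curvature x y * differential F x x) /
  form (level_normal x) (level_normal x).

Definition acceleration x y :=
  quadric_curvature x y *: x + level_curvature x y *: level_normal x.

Lemma form_acceleration x y : form x x != 0 -> form x (acceleration x y) = - form y y.
Proof.
move=> xx; rewrite formDr !formZr [form x (level_normal x)]formC form_normal_self//.
by rewrite mulr0 addr0 divfK.
Qed.

Lemma differential_acceleration x y : form x x != 0 ->
  form (level_normal x) (level_normal x) != 0 ->
  differential F x (acceleration x y) = - hessian F x y y.
Proof.
move=> xx nn; rewrite differentialD !differentialZ differential_normal//.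
by rewrite /level_curvature divfK// opprD addrA addrAC subrr add0r.
Qed.

End LevelSet.

Section LevelGeodesic.
Variables (F : 'rV[R]_m.+2 -> R) (U N : set 'rV[R]_m.+2).
Hypotheses (U_open : open U) (F_smooth : smooth_on U F)
  (NM : N `<=` M) (NF : forall x, U x -> M x -> (N x <-> F x = 0)).

Let FC x : U x -> C1_at F x.
Proof. by move=> Ux; apply: (Ck_on_C1_at (k := 0) U_open Ux); exact: F_smooth. Qed.

Let FC1 i x : U x -> C1_at (partial F i) x.
Proof.
move=> Ux; apply: (Ck_on_C1_at (k := 0) U_open Ux).
by apply: Ck_on_partial; exact: F_smooth.
Qed.

Let FC2 i j x : U x -> C1_at (partial (partial F i) j) x.
Proof.
move=> Ux; apply: (Ck_on_C1_at (k := 0) U_open Ux).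
by do 2!apply: Ck_on_partial; exact: F_smooth.
Qed.

Lemma tangent_level p v : U p -> N p -> tangent N p v ->
  form p v = 0 /\ differential F p v = 0.
Proof.
move=> Up Np [c [c0 dc Nc]]; split.
  apply: (@tangent_form R m g r); exists c; split=> //.
  by apply: filterS Nc => u; exact: NM.
have cU : \forall u \near (0 : R), U (c u).
  by apply: (is_derive_continuous dc); rewrite c0; exact: open_nbhs_nbhs.
move/is_derive1P: dc => dc.
have := @has_derivative_on_comp R _ F setT c 0 v; rewrite c0 => /(_ (FC Up) dc) H.
apply: (has_derivative_on_unique (@setT_limit_point R 0) H).
apply: has_derivative_on_near (has_derivative_on_cst setT (0 : R) 0).
  by rewrite /= c0; apply/esym/NF => //; exact: NM.
rewrite withinET; apply: filterS2 cU Nc => u Uu Nu; split=> //.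
by apply/esym/NF => //; exact: NM.
Qed.

Local Notation d2 := (m.+2 + m.+2)%N.
(** The equation of second order is solved in the phase space, a point of which
    is made of a position [X] and a velocity [Y]. *)
Let X (z : 'rV[R]_d2) : 'rV[R]_m.+2 := lsubmx z.
Let Y (z : 'rV[R]_d2) : 'rV[R]_m.+2 := rsubmx z.
Local Notation nu := (level_normal F).

Let X_lip z : row_lipschitz_near X z.
Proof.
move=> i; under [G in lipschitz_near G]eq_fun do rewrite mxE.
exact: lipschitz_near_coord.
Qed.

Let Y_lip z : row_lipschitz_near Y z.
Proof.
move=> i; under [G in lipschitz_near G]eq_fun do rewrite mxE.
exact: lipschitz_near_coord.
Qed.

Let comp_X_lip (G : 'rV[R]_m.+2 -> R) z : C1_at G (X z) ->
  lipschitz_near (fun z => G (X z)) z.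
Proof.
move=> /C1_lipschitz_near; apply: lipschitz_near_comp => x y.
apply: row_norm_le => // i; rewrite !mxE.
by have := ler_coord_norm (x - y) (lshift _ i); rewrite !mxE.
Qed.

Let dF_lip (a : 'rV[R]_d2 -> 'rV[R]_m.+2) z : U (X z) -> row_lipschitz_near a z ->
  lipschitz_near (fun z => differential F (X z) (a z)) z.
Proof.
move=> Uz az; apply: lipschitz_near_sum => i; apply: lipschitz_nearM => //.
by apply: comp_X_lip; exact: FC1.
Qed.

Let nu_lip z : U (X z) -> form (X z) (X z) != 0 ->
  row_lipschitz_near (fun z => nu (X z)) z.
Proof.
move=> Uz zz; apply: row_lipschitz_nearD => [i|].
  under [G in lipschitz_near G]eq_fun do rewrite mxE.
  apply: lipschitz_nearM; first exact: lipschitz_near_cst.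
  by apply: comp_X_lip; exact: FC1.
apply: row_lipschitz_nearN; apply: row_lipschitz_nearZ (@X_lip z).
apply: lipschitz_nearM; first exact: dF_lip.
by apply: lipschitz_nearV => //; exact: form_lipschitz_near.
Qed.

Let acc_lip z : U (X z) -> form (X z) (X z) != 0 ->
  form (nu (X z)) (nu (X z)) != 0 ->
  row_lipschitz_near (fun z => acceleration F (X z) (Y z)) z.
Proof.
move=> Uz zz nn.
have lq : lipschitz_near (fun z => quadric_curvature (X z) (Y z)) z.
  apply: lipschitz_nearM; last by apply: lipschitz_nearV => //; exact: form_lipschitz_near.
  by apply: lipschitz_nearN; exact: form_lipschitz_near.
have ln := nu_lip Uz zz.
apply: row_lipschitz_nearD; apply: row_lipschitz_nearZ => //.
apply: lipschitz_nearM; last by apply: lipschitz_nearV => //; exact: form_lipschitz_near.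
apply: lipschitz_nearN; apply: lipschitz_nearD; last first.
  by apply: lipschitz_nearM => //; exact: dF_lip.
apply: lipschitz_near_sum => i; apply: lipschitz_nearM; last exact: Y_lip.
apply: lipschitz_near_sum => j; apply: lipschitz_nearM; last exact: Y_lip.
by apply: comp_X_lip; exact: FC2.
Qed.

(** A solution of the differential equation stays in [N], because the functions
    [form c w], [form c c], [differential F c w] and [F \o c] have derivative
    zero: the acceleration makes the first and the third constant, and each of
    them, being zero, makes the next one constant. *)
Lemma level_geodesic_exists p v : U p -> N p ->
  form (nu p) (nu p) != 0 -> form p v = 0 -> differential F p v = 0 ->
  exists (e : R) (c w : R -> 'rV[R]_m.+2), [/\ 0 < e, c 0 = p, w 0 = v &
    forall s : R, `|s| < e ->
    [/\ is_derive s 1 c (w s), is_derive s 1 w (acceleration F (c s) (w s)),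
        acceleration F (c u) (w u) @[u --> s] --> acceleration F (c s) (w s),
        U (c s) & N (c s)] ].
Proof.
move=> Up Np nn pv Fv; have Mp := NM Np.
have pp := ambient_space_form Mp; have e0 := quadric_level_neq0 g r_gt0.
pose z0 := row_mx p v.
have Xz0 : X z0 = p by exact: row_mxKl.
have Yz0 : Y z0 = v by exact: row_mxKr.
have pp0 : form p p != 0 by rewrite pp.
have aL : row_lipschitz_near (fun z => acceleration F (X z) (Y z)) z0.
  by apply: acc_lip; rewrite Xz0.
have [|e1 e10 [z [zz0 dz]]] := @picard_local R _
    (fun z => row_mx (Y z) (acceleration F (X z) (Y z))) z0.
  move=> i; case: (split_ordP i) => j ->.
    by under [G in lipschitz_near G]eq_fun do rewrite row_mxEl; exact: Y_lip.
  by under [G in lipschitz_near G]eq_fun do rewrite row_mxEr; exact: aL.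
pose c s := X (z s); pose w s := Y (z s).
have dc (s : R) : `|s| < e1 -> is_derive s 1 c (w s).
  move=> /dz/is_derive1P/has_derivative_on_rowP H.
  apply/is_derive1P/has_derivative_on_rowP => i.
  have := H (lshift _ i); rewrite row_mxEl.
  by under [G in _ -> has_derivative_on _ G _ _]eq_fun do rewrite mxE.
have dw (s : R) : `|s| < e1 -> is_derive s 1 w (acceleration F (c s) (w s)).
  move=> /dz/is_derive1P/has_derivative_on_rowP H.
  apply/is_derive1P/has_derivative_on_rowP => i.
  have := H (rshift _ i); rewrite row_mxEr.
  by under [G in _ -> has_derivative_on _ G _ _]eq_fun do rewrite mxE.
have z00 : `|0 : R| < e1 by rewrite normr0.
have c0 : c 0 = p by rewrite /c zz0.
have w0 : w 0 = v by rewrite /w zz0.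
have zc (s : R) : `|s| < e1 -> z u @[u --> s] --> z s.
  by move=> /dz/is_derive_continuous.
have cc (s : R) : `|s| < e1 -> c u @[u --> s] --> c s.
  by move=> /dc/is_derive_continuous.
have N1 : \forall u \near (0 : R), U (c u).
  by apply: (cc 0 z00); rewrite c0; exact: open_nbhs_nbhs.
have N2 : \forall u \near (0 : R), form (c u) (c u) != 0.
  have /is_derive1P H := dc 0 z00.
  have /is_derive1P/is_derive_continuous/cvgr_neq0 := has_derivative_on_form g H H.
  by rewrite c0; apply.
have N3 : \forall u \near (0 : R), form (nu (c u)) (nu (c u)) != 0.
  have nL : lipschitz_near (fun z => form (nu (X z)) (nu (X z))) z0.
    by apply: form_lipschitz_near; apply: nu_lip; rewrite Xz0.
  have [dn dn0 Hn] := lipschitz_near_cvg nL.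
  have := Hn _ _ (nbhs_filter (0 : R)) z z0; rewrite subrr normr0 -[X in _ --> X -> _]zz0.
  move=> /(_ dn0 (zc 0 z00))/cvgr_neq0; apply; by rewrite Xz0.
have [da da0 Ha] := lipschitz_near_cvg (lipschitz_near_row aL).
have N4 : \forall u \near (0 : R), `|z u - z0| < da.
  have /cvgrPdist_lt/(_ da da0) := zc 0 z00; apply: filterS => u.
  by rewrite zz0 distrC.
have N5 : \forall u \near (0 : R), g = Hyperbolic -> 0 < c u 0 0.
  case: (g) Mp => [_|[_ p0]]; first by near=> u.
  have /is_derive_continuous : is_derive (0 : R) 1 (fun u => c u 0 0) (w 0 0 0).
    by apply/is_derive1P/has_derivative_on_coord/is_derive1P; exact: dc.
  by move/cvgr_gt; rewrite c0 => /(_ 0 p0); apply: filterS.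
have [e2 e20 He] := (@nbhs_distP R _ (0 : R) _).1
  (filterI (filterI (filterI N1 N2) (filterI N3 N4)) N5).
pose e := Num.min e1 e2.
have J_itv : is_interval [set s : R | `|s| < e].
  move=> a b; rewrite /= !ltr_norml => /andP[a1 a2] /andP[b1 b2] x /andP[ax xb].
  by rewrite ltr_norml (lt_le_trans a1 ax) (le_lt_trans xb b2).
have J0 : [set s : R | `|s| < e] 0 by rewrite /= normr0 lt_min e10.
have e1e (s : R) : `|s| < e -> `|s| < e1 by rewrite lt_min => /andP[].
have e2e (s : R) : `|s| < e -> `|s - 0| < e2 by rewrite lt_min subr0 => /andP[].
(* All four conserved quantities are handled on the same open interval. *)
have zero_derivative (h : R -> R) :
    (forall s, `|s| < e -> has_derivative_on [set s : R | `|s| < e] h s 0) ->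
    forall s, `|s| < e -> h s = h 0.
  by move=> H s se; apply: (has_derivative_on0_cst J_itv H).
exists e, c, w; split=> //; first by rewrite lt_min e10.
have cw (s : R) : `|s| < e -> form (c s) (w s) = 0.
  move=> se; rewrite (zero_derivative (fun s => form (c s) (w s)))// ?c0 ?w0//.
  move=> u ue; have := has_derivative_on_form g (is_derive1_on _ (dc u (e1e u ue)))
    (is_derive1_on [set s : R | `|s| < e] (dw u (e1e u ue))).
  have [[[_ cu] _] _] := He u (e2e u ue).
  by rewrite form_acceleration// subrr.
have cM (s : R) : `|s| < e -> M (c s).
  move=> se; have cE : form (c s) (c s) = quadric_level g r.
    rewrite (zero_derivative (fun s => form (c s) (c s)))// ?c0//.
    move=> u ue; have du := is_derive1_on [set s : R | `|s| < e] (dc u (e1e u ue)).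
    by have := has_derivative_on_form g du du; rewrite formC cw// addr0.
  have [_ c00] := He s (e2e s se); move: cE c00; rewrite /quadric_level.
  by case: (g) => // cE /(_ erefl) c00; split.
have Fw (s : R) : `|s| < e -> differential F (c s) (w s) = 0.
  move=> se; rewrite (zero_derivative (fun s => differential F (c s) (w s)))// ?c0 ?w0//.
  move=> u ue; have [[[Uu cu] [nu _]] _] := He u (e2e u ue).
  have := has_derivative_on_differential (fun i => FC1 i Uu)
    (is_derive1_on _ (dc u (e1e u ue)))
    (is_derive1_on [set s : R | `|s| < e] (dw u (e1e u ue))).
  by rewrite differential_acceleration// subrr.
have F0 (s : R) : `|s| < e -> F (c s) = 0.
  move=> se; rewrite (zero_derivative (fun s => F (c s)))//; first by rewrite c0; apply/NF.
  move=> u ue; have [[[Uu _] _] _] := He u (e2e u ue).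
  rewrite -(Fw u ue).
  exact: (has_derivative_on_comp (FC Uu) (is_derive1_on _ (dc u (e1e u ue)))).
move=> s se; have [[[Us cs] [ns zs]] _] := He s (e2e s se).
split=> //; [exact/dc/e1e|exact/dw/e1e| |by apply/NF; [|exact: cM|exact: F0]].
exact: (Ha _ _ (nbhs_filter s) _ _ zs (zc s (e1e s se))).
Unshelve. all: by end_near. Qed.

(** Conversely, a vector [v] satisfying both equations is tangent because [N]
    contains a geodesic of initial velocity [v]. *)
Lemma level_tangentP p v : U p -> N p -> form (nu p) (nu p) != 0 ->
  tangent N p v <-> form p v = 0 /\ differential F p v = 0.
Proof.
move=> Up Np nn; split; first exact: tangent_level.
move=> [pv Fv]; have [e [c [w [e0 c0 w0 H]]]] := level_geodesic_exists Up Np nn pv Fv.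
exists c; split=> //; first by rewrite -w0; have [] := H 0; rewrite ?normr0.
apply/nbhs_distP; exists e => // u; rewrite subr0 => ue.
by have [] := H u ue.
Qed.

(** A geodesic of the quadric has no acceleration along [nu p]; for the
    geodesic of [N] with velocity [v] this says that [level_curvature]
    vanishes. *)
Let hessian_diagonal p v : totally_geodesic g r N -> U p -> N p ->
  form (nu p) (nu p) != 0 -> form p v = 0 -> differential F p v = 0 ->
  hessian F p v v = form v v / form p p * differential F p p.
Proof.
move=> tgN Up Np nn pv Fv; have Mp := NM Np.
have pp0 : form p p != 0 by rewrite (ambient_space_form Mp) quadric_level_neq0.
have [e [c [w [e0 c0 w0 H]]]] := level_geodesic_exists Up Np nn pv Fv.
pose J := [set s : R | `|s| < e].
have J_itv : is_interval J.
  move=> a b; rewrite /J/= !ltr_norml => /andP[a1 a2] /andP[b1 b2] x /andP[ax xb].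
  by rewrite ltr_norml (lt_le_trans a1 ax) (le_lt_trans xb b2).
have J0 : J 0 by rewrite /J/= normr0.
have J_int : interior J !=set0.
  exists 0; apply/nbhs_distP; exists e => // u; by rewrite subr0.
have J_acc s : J s -> forall d, 0 < d -> exists u, [/\ J u, u != s & `|u - s| < d].
  by move=> Js d; exact: interval_limit_point.
have geoN : geodesic g N J c.
  split=> [s /H[]//||].
    exists w, (fun s => acceleration F (c s) (w s)); split=> [s /H[dc _ _ _ _]|s /H[_ dw _ _ _]|].
    - exact: is_derive1_on.
    - exact: is_derive1_on.
    - apply: continuous_in_subspaceT => s; rewrite inE => /H[_ _ + _ _]; exact.
  exists w => s Js; have [dc dw _ Us Ns] := H s Js; split; first exact: is_derive1_on.
  exists (acceleration F (c s) (w s)); split; first exact: is_derive1_on.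
    by exists (fun=> c s); split; [|exact: is_derive_cst|by exists 1 => /=].
  move=> u /(tangent_level Us Ns)[cu Fu].
  by rewrite subr0 formDl !formZl cu form_normal// Fu !mulr0 addr0.
have [_ _ [w' Hw]] := tgN J c J_itv J_int geoN.
have ww s : J s -> w' s = w s.
  move=> Js; apply: (has_derivative_on_unique (J_acc s Js)); first exact: (Hw s Js).1.
  by have [dc _ _ _ _] := H s Js; exact: is_derive1_on.
have [_ [l [dw' _ Hl]]] := Hw 0 J0.
have lE : l = acceleration F p v.
  have [_ dw _ _ _] := H 0 J0; rewrite c0 w0 in dw.
  apply: (has_derivative_on_unique (J_acc 0 J0)) (is_derive1_on J dw).
  exact: eq_has_derivative_on dw'.
have tn : tangent M (c 0) (nu p).
  by rewrite c0; apply/tangentP => //; rewrite formC form_normal_self.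
have := Hl _ tn; rewrite lE subr0 formDl !formZl [form p (nu p)]formC.
rewrite form_normal_self// mulr0 add0r => /eqP; rewrite mulf_eq0 (negPf nn) orbF.
rewrite mulf_eq0 invr_eq0 (negPf nn) orbF oppr_eq0 => /eqP/(canRL (addrK _)) ->.
by rewrite add0r /quadric_curvature !mulNr opprK.
Unshelve. all: by end_near. Qed.

(** The second fundamental form is symmetric, so that its vanishing on the
    diagonal, which is what geodesics give, makes it vanish altogether. *)
Lemma totally_geodesic_hessian p v w : totally_geodesic g r N -> U p -> N p ->
  form (nu p) (nu p) != 0 -> form p v = 0 -> differential F p v = 0 ->
  form p w = 0 -> differential F p w = 0 ->
  hessian F p v w = form v w / form p p * differential F p p.
Proof.
move=> tgN Up Np nn pv Fv pw Fw.
have H u := @hessian_diagonal p u tgN Up Np nn.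
have := H (v + w); rewrite formDr pv pw addr0 differentialD Fv Fw addr0.
move=> /(_ erefl erefl).
rewrite !(hessianDl, hessianDr) !(formDl, formDr) [form w v]formC.
rewrite (hessianC w v U_open Up (F_smooth 2)) (H v pv Fv) (H w pw Fw).
by move=> ?; apply: (mulfI (_ : (2 : R) != 0)) => //; lra.
Qed.

End LevelGeodesic.
End Geodesics.

(** * Curves in a totally geodesic hypersurface *)

Section Parallel.
Variables (R : realType) (m : nat).
Implicit Types (a b : 'I_m -> R).

Lemma orthogonal_parallel a b :
  (forall c : 'I_m -> R, \sum_i c i * b i = 0 -> \sum_i c i * a i = 0) ->
  forall i j, a i * b j = a j * b i.
Proof.
move=> H i j; (* The vector of the plane of the coordinates [i] and [j] orthogonal to [b]. *)
pose c k := (k == i)%:R * b j - (k == j)%:R * b i.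
have cE x : \sum_k c k * x k = b j * x i - b i * x j.
  under eq_bigr do rewrite mulrBl -!mulrA.
  rewrite sumrB (bigD1 i)//= big1 => [|k /negPf ki]; last by rewrite ki mul0r.
  rewrite eqxx mul1r addr0 (bigD1 j)//= big1 => [|k /negPf kj]; last by rewrite kj mul0r.
  by rewrite eqxx mul1r addr0.
have := H c; rewrite !cE mulrC subrr => /(_ erefl)/eqP; rewrite subr_eq0 => /eqP.
by rewrite ![b _ * _]mulrC.
Qed.

Lemma parallel_projector a b i j :
  (forall k l, a k * b l = a l * b k) ->
  \sum_k a k ^+ 2 != 0 -> \sum_k b k ^+ 2 != 0 ->
  a i * a j / (\sum_k a k ^+ 2) = b i * b j / (\sum_k b k ^+ 2).
Proof.
move=> ab a0 b0; apply/eqP; rewrite eqr_div// !mulr_sumr; apply/eqP.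
apply: eq_bigr => k _.
have -> : a i * a j * b k ^+ 2 = (a i * b k) * (a j * b k) by ring.
by rewrite (ab i k) (ab j k); ring.
Qed.

(** The orthogonal projector on a moving line is constant to first order when
    the derivative of a spanning vector lies on the line. *)
Lemma has_derivative_on_projector (I : set R) (b : 'I_m -> R -> R) (s : R)
    (db : 'I_m -> R) i j :
  (forall k, has_derivative_on I (b k) s (db k)) ->
  (forall k l, db k * b l s = db l * b k s) ->
  \sum_k b k s ^+ 2 != 0 ->
  has_derivative_on I (fun u => b i u * b j u / (\sum_k b k u ^+ 2)) s 0.
Proof.
move=> Hb par B0.
have HB : has_derivative_on I (fun u => \sum_k b k u ^+ 2) s
    (\sum_k (db k * b k s + b k s * db k)).
  apply: has_derivative_on_sum => k.
  under [X in has_derivative_on _ X]eq_fun do rewrite expr2.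
  exact: has_derivative_onM.
have := has_derivative_onM (has_derivative_onM (Hb i) (Hb j)) (has_derivative_onV B0 HB).
suff -> : (db i * b j s + b i s * db j) / (\sum_k b k s ^+ 2) +
    b i s * b j s * (- (\sum_k (db k * b k s + b k s * db k)) /
      (\sum_k b k s ^+ 2) ^+ 2) = 0 by [].
have -> : b i s * b j s * (- (\sum_k (db k * b k s + b k s * db k)) /
      (\sum_k b k s ^+ 2) ^+ 2) =
    - (b i s * b j s * (\sum_k (db k * b k s + b k s * db k))) /
      (\sum_k b k s ^+ 2) ^+ 2 by rewrite mulrA mulrN.
have -> : b i s * b j s * (\sum_k (db k * b k s + b k s * db k)) =
    (db i * b j s + b i s * db j) * (\sum_k b k s ^+ 2).
  rewrite !mulr_sumr; apply: eq_bigr => k _.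
  have -> : b i s * b j s * (db k * b k s + b k s * db k) =
    (db k * b i s) * b j s * b k s + (db k * b j s) * b i s * b k s by ring.
  by rewrite (par k i) (par k j); ring.
by field.
Qed.

End Parallel.

Section RotationMinimizingFrame.
Variables (R : realType) (g : space_form) (m : nat) (r : R)
  (I : set R) (alpha t : R -> 'rV[R]_m.+2) (n : 'I_m -> R -> 'rV[R]_m.+2)
  (kappa : 'I_m -> R -> R).
Hypotheses (r_gt0 : 0 < r) (itvI : is_interval I) (I_nondeg : interior I !=set0)
  (alphaC2 : arclength_C2_curve g r I alpha t)
  (frame : rm_frame g r I alpha t n kappa).
Local Notation form := (@ambient_form R m g).
Local Notation M := (@ambient_space R m g r).
Implicit Types (s u : R) (x y v w : 'rV[R]_m.+2).

Let I_acc s : I s -> forall d, 0 < d -> exists u, [/\ I u, u != s & `|u - s| < d].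
Proof. by move=> Is d; exact: interval_limit_point. Qed.

Lemma curve_in_space s : I s -> M (alpha s).
Proof. by have [H _ _] := alphaC2; exact: H. Qed.

Lemma form_alpha_neq0 s : I s -> form (alpha s) (alpha s) != 0.
Proof.
by move=> Is; rewrite (ambient_space_form (curve_in_space Is)) quadric_level_neq0.
Qed.

Lemma curve_derivative s : I s -> has_derivative_on I alpha s (t s).
Proof. by have [_ _ H] := alphaC2; move=> /H[]. Qed.

Lemma form_alpha_t s : I s -> form (alpha s) (t s) = 0.
Proof. by move=> /frame[[/tangent_form]]. Qed.

Lemma form_alpha_n i s : I s -> form (alpha s) (n i s) = 0.
Proof. by move=> /frame[[_ /(_ i)/tangent_form]]. Qed.

Lemma form_t_t s : I s -> form (t s) (t s) = 1.
Proof. by move=> /frame[_ []]. Qed.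

Lemma form_t_n i s : I s -> form (t s) (n i s) = 0.
Proof. by move=> /frame[_ []]. Qed.

Lemma form_n_n i j s : I s -> form (n i s) (n j s) = (i == j)%:R.
Proof. by move=> /frame[_ _]. Qed.

Lemma frame_separates s x : I s -> form (alpha s) x = 0 -> form (t s) x = 0 ->
  (forall i, form (n i s) x = 0) -> x = 0.
Proof.
move=> Is ax tx nx.
apply: (@frame_span R m g (alpha s) (t s) (fun i => n i s)).
- exact: form_alpha_neq0.
- exact: form_alpha_t.
- by move=> i; exact: form_alpha_n.
- exact: form_t_t.
- by move=> i; exact: form_t_n.
- by move=> i j; exact: form_n_n.
- by rewrite formC.
- by rewrite formC.
- by move=> i; rewrite formC.
Qed.

Lemma orthogonal_to_tangent s x : I s -> form x (alpha s) = 0 ->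
  (forall v, tangent M (alpha s) v -> form x v = 0) -> x = 0.
Proof.
move=> Is xa xv; have [[tt tn] _ _ _ _] := frame Is.
apply: (frame_separates Is); first by rewrite formC.
  by rewrite formC; exact: xv.
by move=> i; rewrite formC; exact: xv.
Qed.

(** The covariant and the flat derivative of [n i] agree, because the latter is
    orthogonal to [alpha]. *)
Lemma n_derivative i s : I s -> has_derivative_on I (n i) s (- kappa i s *: t s).
Proof.
move=> Is; have [_ _ _ _ /(_ i)[l [nl _ Hl]]] := frame Is.
suff -> : - kappa i s *: t s = l by [].
apply/esym/eqP; rewrite -subr_eq0; apply/eqP; apply: (orthogonal_to_tangent Is _ Hl).
have H := has_derivative_on_form g nl (curve_derivative Is).
have : has_derivative_on I (fun u => form (n i u) (alpha u)) s 0.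
  apply: eq_has_derivative_on Is _ (has_derivative_on_cst I (0 : R) s) => u Iu.
  by rewrite formC form_alpha_n.
move=> /(has_derivative_on_unique (I_acc Is) H); rewrite formC [form (n i s) _]formC.
rewrite form_t_n// addr0 => al.
by rewrite formBl formZl [form l _]formC al [form (t s) _]formC form_alpha_t// mulr0 subrr.
Qed.

(** The last term is the acceleration of a geodesic of the quadric in the
    ambient space; it keeps [t] orthogonal to [alpha]. *)
Lemma t_derivative s : I s -> has_derivative_on I t s
  (\sum_i kappa i s *: n i s - (form (alpha s) (alpha s))^-1 *: alpha s).
Proof.
move=> Is; have [_ _ _ [l [tl _ Hl]] _] := frame Is.
suff -> : \sum_i kappa i s *: n i s - (form (alpha s) (alpha s))^-1 *: alpha s = l.
  by [].
have la : form l (alpha s) = - 1.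
  have H := has_derivative_on_form g tl (curve_derivative Is).
  have : has_derivative_on I (fun u => form (t u) (alpha u)) s 0.
    apply: eq_has_derivative_on Is _ (has_derivative_on_cst I (0 : R) s) => u Iu.
    by rewrite formC form_alpha_t.
  move=> /(has_derivative_on_unique (I_acc Is) H); rewrite form_t_t// => /eqP.
  by rewrite addr_eq0 => /eqP.
have sa : form (\sum_i kappa i s *: n i s) (alpha s) = 0.
  by rewrite form_suml big1// => i _; rewrite formZl formC form_alpha_n// mulr0.
apply/esym/eqP; rewrite -subr_eq0; apply/eqP; apply: (orthogonal_to_tangent Is).
  by rewrite !formBl formZl la sa mulVf ?form_alpha_neq0// sub0r opprK addNr.
move=> v Mv; rewrite opprB formDl formBl formZl (tangent_form Mv) mulr0 sub0r.
by have := Hl v Mv; rewrite formBl.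
Qed.

Section CurveInHypersurface.
Variable N : set 'rV[R]_m.+2.
Hypotheses (N_hyper : hypersurface g r N) (N_tg : totally_geodesic g r N)
  (alphaN : forall s, I s -> N (alpha s)).
Variable eta : 'rV[R]_m.+2 -> 'rV[R]_m.+2.
Hypothesis eta_normal : forall p, N p ->
  [/\ tangent M p (eta p), form (eta p) (eta p) = 1
    & forall v, tangent N p v -> form (eta p) v = 0].

Let a i s := form (eta (alpha s)) (n i s).

Let NM : N `<=` M. Proof. by case: N_hyper. Qed.

(** Everything here takes place near a point of the curve, where [N] is given
    by an equation. The [b i] are the coordinates of the normal in the frame, by
    [normal_expansion]. *)
Section LocalEquation.
Variables (U : set 'rV[R]_m.+2) (F : 'rV[R]_m.+2 -> R).
Hypotheses (U_open : open U) (F_smooth : smooth_on U F)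
  (NF : forall x, U x -> M x -> (N x <-> F x = 0))
  (F_regular : forall x, U x -> N x -> exists2 v, tangent M x v & 'D_v F x != 0).

Let b i s := differential F (alpha s) (n i s).

Let FC1 x : U x -> C1_at F x.
Proof. by move=> Ux; apply: (Ck_on_C1_at (k := 0) U_open Ux); exact: F_smooth. Qed.

Let dFC1 i x : U x -> C1_at (partial F i) x.
Proof.
move=> Ux; apply: (Ck_on_C1_at (k := 0) U_open Ux).
by apply: Ck_on_partial; exact: F_smooth.
Qed.

Let near_U s : I s -> U (alpha s) ->
  \forall u \near within I (nbhs s), I u /\ U (alpha u).
Proof.
move=> Is Us; have := curve_derivative Is.
move=> /has_derivative_on_cvg/(_ U (open_nbhs_nbhs (conj U_open Us))).
move=> [d /= d0 Hd]; exists d => // u us Iu; split=> //.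
have [->|us0] := eqVneq u s; first by [].
exact: Hd.
Qed.

Let dF_t s : I s -> U (alpha s) -> differential F (alpha s) (t s) = 0.
Proof.
move=> Is Us; apply: (has_derivative_on_unique (I_acc Is)).
  exact: has_derivative_on_comp (FC1 Us) (curve_derivative Is).
apply: has_derivative_on_near (has_derivative_on_cst I (0 : R) s).
  by apply/esym/NF; [|exact: curve_in_space|exact: alphaN].
apply: filterS (near_U Is Us) => u [Iu Uu]; split=> //.
by apply/esym/NF; [|exact: curve_in_space|exact: alphaN].
Qed.

Let normal_expansion s : I s -> U (alpha s) ->
  level_normal g F (alpha s) = \sum_i b i s *: n i s.
Proof.
move=> Is Us; apply/eqP; rewrite -subr_eq0; apply/eqP.
have aa := form_alpha_neq0 Is.
apply: (frame_separates Is).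
- rewrite formC formBl form_normal_self// sub0r form_suml big1 ?oppr0// => i _.
  by rewrite formZl formC form_alpha_n// mulr0.
- rewrite formC formBl form_normal ?form_alpha_t// dF_t// sub0r form_suml.
  by rewrite big1 ?oppr0// => i _; rewrite formZl formC form_t_n// mulr0.
move=> j; rewrite formC formBl form_normal ?form_alpha_n// form_suml.
rewrite (bigD1 j)//= big1 => [|i ij]; rewrite formZl form_n_n//.
  by rewrite eqxx mulr1 addr0 subrr.
by rewrite (negPf ij) mulr0.
Qed.

Let form_normal_normal s : I s -> U (alpha s) ->
  form (level_normal g F (alpha s)) (level_normal g F (alpha s)) = \sum_i b i s ^+ 2.
Proof.
move=> Is Us; rewrite {1}normal_expansion// form_suml; apply: eq_bigr => i _.
by rewrite formZl formC form_normal ?form_alpha_n// expr2.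
Qed.

Let b_neq0 s : I s -> U (alpha s) -> \sum_i b i s ^+ 2 != 0.
Proof.
move=> Is Us; have [v Mv] := F_regular Us (alphaN Is).
rewrite (derive_differential _ (FC1 Us)); apply: contra_neqN => /eqP b0.
rewrite -(@form_normal R m g F _ _ (tangent_form Mv)) normal_expansion// form_suml big1// => i _.
have /eqP := b0; rewrite psumr_eq0 => [/allP/(_ i)|j _]; last exact: sqr_ge0.
rewrite mem_index_enum => /(_ isT); rewrite sqrf_eq0 => /eqP ->.
by rewrite formZl mul0r.
Qed.

Let normal_neq0 s : I s -> U (alpha s) ->
  form (level_normal g F (alpha s)) (level_normal g F (alpha s)) != 0.
Proof. by move=> Is Us; rewrite form_normal_normal// b_neq0. Qed.

Let combination (c : 'I_m -> R) s := \sum_i c i *: n i s.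

Let form_alpha_combination c s : I s -> form (alpha s) (combination c s) = 0.
Proof.
move=> Is; rewrite form_sumr big1// => i _.
by rewrite formZr form_alpha_n// mulr0.
Qed.

Let dF_combination c s :
  differential F (alpha s) (combination c s) = \sum_i c i * b i s.
Proof.
exact: differential_sum.
Qed.

(** Combinations of the [n i] annihilated by the differential are tangent to
    the hypersurface, and [eta] is orthogonal to them. *)
Let a_orthogonal c s : I s -> U (alpha s) -> \sum_i c i * b i s = 0 ->
  \sum_i c i * a i s = 0.
Proof.
move=> Is Us cb; have Ns := alphaN Is.
have [_ _ /(_ (combination c s)) H] := eta_normal Ns.
rewrite -[RHS]H; first by rewrite form_sumr; apply: eq_bigr => i _; rewrite formZr.
apply/(@level_tangentP R m g r r_gt0 F U N U_open F_smooth NM NF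
  (alpha s) (combination c s) Us Ns (normal_neq0 Is Us)).
by rewrite form_alpha_combination// dF_combination.
Qed.

Let db i s := hessian F (alpha s) (n i s) (t s).

Let b_derivative i s : I s -> U (alpha s) -> has_derivative_on I (b i) s (db i s).
Proof.
move=> Is Us; have := has_derivative_on_differential (fun j => dFC1 j Us)
  (curve_derivative Is) (@n_derivative i s Is).
by rewrite differentialZ dF_t// mulr0 addr0.
Qed.

(** As [t] is tangent to the hypersurface, the Hessian formula applies to it and
    to any combination of the [n i] annihilated by the differential; such a
    combination is orthogonal to [t]. *)
Let db_orthogonal c s : I s -> U (alpha s) -> \sum_i c i * b i s = 0 ->
  \sum_i c i * db i s = 0.
Proof.
move=> Is Us cb; have Ns := alphaN Is.
have := totally_geodesic_hessian r_gt0 U_open F_smooth NM NF N_tg Us Ns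
  (normal_neq0 Is Us) (form_alpha_combination c Is) _ (form_alpha_t Is) (dF_t Is Us).
rewrite dF_combination => /(_ cb).
have -> : form (combination c s) (t s) = 0.
  by rewrite formC form_sumr big1// => i _; rewrite formZr form_t_n// mulr0.
by rewrite !mul0r hessian_suml.
Qed.

(** This is the derivative of the relation [dF_t] along the curve. *)
Let kappa_b s : I s -> U (alpha s) -> \sum_i kappa i s * b i s = 0.
Proof.
move=> Is Us; have Ns := alphaN Is.
have H := has_derivative_on_differential (fun j => dFC1 j Us)
  (curve_derivative Is) (t_derivative Is).
have : has_derivative_on I (fun u => differential F (alpha u) (t u)) s 0.
  apply: has_derivative_on_near (has_derivative_on_cst I (0 : R) s).
    by rewrite dF_t.
  by apply: filterS (near_U Is Us) => u [Iu Uu]; rewrite dF_t.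
move=> /(has_derivative_on_unique (I_acc Is) H).
rewrite (totally_geodesic_hessian r_gt0 U_open F_smooth NM NF N_tg Us Ns
  (normal_neq0 Is Us) (form_alpha_t Is) (dF_t Is Us) (form_alpha_t Is) (dF_t Is Us)).
rewrite form_t_t// div1r differentialD -scaleNr differentialZ.
rewrite -/(combination (kappa^~ s) s) dF_combination mulNr.
by rewrite addrC subrK.
Qed.

Let a_neq0 s : I s -> U (alpha s) -> \sum_i a i s ^+ 2 != 0.
Proof.
move=> Is Us; have Ns := alphaN Is; apply/eqP => a0.
have ai0 i : a i s = 0.
  have /eqP := a0; rewrite psumr_eq0 => [/allP/(_ i)|j _]; last exact: sqr_ge0.
  by rewrite mem_index_enum => /(_ isT); rewrite sqrf_eq0 => /eqP.
have [eta_tg eta1 eta_orth] := eta_normal Ns.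
suff e0 : eta (alpha s) = 0.
  by move: eta1; rewrite e0 form0l => /esym/eqP; rewrite oner_eq0.
apply: (frame_separates Is); first exact: tangent_form eta_tg.
  rewrite formC; apply: eta_orth.
  apply/(@level_tangentP R m g r r_gt0 F U N U_open F_smooth NM NF
    (alpha s) (t s) Us Ns (normal_neq0 Is Us)).
  by rewrite form_alpha_t// dF_t.
by move=> i; rewrite formC; exact: ai0.
Qed.

Let projector i j s := a i s * a j s / (\sum_k a k s ^+ 2).

Let projectorE i j s : I s -> U (alpha s) ->
  projector i j s = b i s * b j s / (\sum_k b k s ^+ 2).
Proof.
move=> Is Us; apply: (@parallel_projector _ _ (a^~ s) (b^~ s)).
- by apply: orthogonal_parallel => c; exact: a_orthogonal.
- exact: a_neq0.
- exact: b_neq0.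
Qed.

(** The vectors [a] and [b] span the same line; that it is constant is read off
    [b], but only [a] makes sense beyond the local equation. *)
Lemma local_normal_line i j s : I s -> U (alpha s) ->
  [/\ has_derivative_on I (projector i j) s 0,
      \sum_k projector i k s * kappa k s = 0 & \sum_k a k s ^+ 2 != 0].
Proof.
move=> Is Us; split; last exact: a_neq0.
  have par k l : db k s * b l s = db l s * b k s.
    by apply: (@orthogonal_parallel _ _ (db^~ s) (b^~ s)) => c; exact: db_orthogonal.
  have := has_derivative_on_projector i j (fun k => @b_derivative k s Is Us) par (b_neq0 Is Us).
  apply: has_derivative_on_near; first by rewrite projectorE.
  by apply: filterS (near_U Is Us) => u [Iu Uu]; rewrite projectorE.
under eq_bigr do rewrite projectorE//.
transitivity (b i s / (\sum_k b k s ^+ 2) * \sum_k kappa k s * b k s).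
  by rewrite mulr_sumr; apply: eq_bigr => k _; ring.
by rewrite kappa_b// mulr0.
Qed.

End LocalEquation.

(** The coefficients are a row of the constant projector, chosen nonzero. *)
Lemma hypersurface_curvatures : (1 <= m)%N -> exists a : 'I_m -> R,
  (exists i, a i != 0) /\
  forall s, I s -> \sum_(i < m) a i * kappa i s = 0.
Proof.
move=> m_gt0; have [s0 /interior_subset Is0] := I_nondeg.
have local s : I s -> forall i j,
    [/\ has_derivative_on I (fun s => a i s * a j s / (\sum_k a k s ^+ 2)) s 0,
      \sum_k a i s * a k s / (\sum_k a k s ^+ 2) * kappa k s = 0 &
      \sum_k a k s ^+ 2 != 0].
  move=> Is i j; have [_ /(_ _ (alphaN Is))[U [F [Uo Us Fs NF Freg]]]] := N_hyper.
  exact: (@local_normal_line U F Uo Fs NF Freg i j s Is Us).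
have [k ak] : exists k, a k s0 != 0.
  apply/existsP; apply: contraT; rewrite negb_exists => /forallP a0.
  have [_ _ /negP[]] := local s0 Is0 (Ordinal m_gt0) (Ordinal m_gt0).
  by rewrite big1// => l _; have := a0 l; rewrite negbK => /eqP ->; rewrite expr0n.
exists (fun j => a k s0 * a j s0 / (\sum_k a k s0 ^+ 2)); split.
  exists k; have [_ _ S0] := local s0 Is0 k k.
  by rewrite !mulf_neq0 ?invr_eq0.
move=> s Is; have [_ H _] := local s Is k k; rewrite -[RHS]H; apply: eq_bigr => j _.
congr (_ * kappa j s).
apply: (@has_derivative_on0_cst R I
  (fun s => a k s * a j s / (\sum_k a k s ^+ 2)) itvI _ s0 s Is0 Is) => u Iu.
by have [] := local u Iu k j.
Qed.

End CurveInHypersurface.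
End RotationMinimizingFrame.

(** * Linear sections of the quadric *)

Section LinearSection.
Variables (R : realType) (g : space_form) (m : nat) (r : R) (w : 'rV[R]_m.+2).
Local Notation form := (@ambient_form R m g).
Local Notation M := (@ambient_space R m g r).
Hypotheses (r_gt0 : 0 < r) (w_gt0 : 0 < form w w).
Implicit Types (p x v : 'rV[R]_m.+2).

Definition linear_section : set 'rV[R]_m.+2 := [set x | M x /\ form w x = 0].

Local Notation N := linear_section.

Lemma is_derive_form x v : is_derive x v (form w) (form w v).
Proof.
apply/is_derive_dirP.
have H : has_derivative_on setT (fun h : R => h *: v + x) (0 : R) v.
  have := has_derivative_onD (has_derivative_onZ (has_derivative_on_id setT 0)
    (has_derivative_on_cst setT v 0)) (has_derivative_on_cst setT x 0).
  by rewrite scale1r scaler0 !addr0.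
have := has_derivative_on_form g (has_derivative_on_cst setT w 0) H.
by rewrite form0l add0r.
Qed.

Lemma smooth_form : smooth_on setT (form w).
Proof.
have form_cont x : {for x, continuous (form w)}.
  have L : lipschitz_near (fun x => form w x) x.
    apply: form_lipschitz_near => i; first exact: lipschitz_near_cst.
    exact: lipschitz_near_coord.
  have [d d0 H] := lipschitz_near_cvg L.
  by apply: (H _ _ (nbhs_filter x) id x) => //; rewrite subrr normr0.
have cst_Ck a k : Ck_on k setT ((fun=> a) : 'rV[R]_m.+2 -> R).
  elim: k a => [|k IH] a; (split; first by move=> x _; exact: cst_continuous) => // i.
  split=> [x _|]; first exact: derivable_cst.
  suff -> : 'D_(delta_mx 0 i) ((fun=> a) : 'rV[R]_m.+2 -> R) = (fun=> 0) by exact: IH.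
  by apply/funext => x; exact: derive_cst.
case=> [|k]; split=> // i; split=> [x _|]; first by have [] := is_derive_form x (delta_mx 0 i).
suff -> : 'D_(delta_mx 0 i) (form w) = (fun=> form w (delta_mx 0 i)) by exact: cst_Ck.
by apply/funext => x; have [_ ->] := is_derive_form x (delta_mx 0 i).
Qed.

Lemma linear_section_tangentP p v : N p ->
  tangent N p v <-> form p v = 0 /\ form w v = 0.
Proof.
move=> [Mp wp]; split=> [Npv|[pv wv]]; last exact: section_tangent.
have [c [c0 /is_derive1P dc Nc]] := Npv; split.
  apply: (@tangent_form R m g r); exists c; split=> //; first exact/is_derive1P.
  by apply: filterS Nc => u [].
have := has_derivative_on_form g (has_derivative_on_cst setT w 0) dc.
rewrite form0l add0r => H; apply: (has_derivative_on_unique (@setT_limit_point R 0) H).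
apply: has_derivative_on_near (has_derivative_on_cst setT (0 : R) 0).
  by rewrite c0 wp.
by rewrite withinET; apply: filterS Nc => u [_ ->].
Qed.

Lemma linear_section_normal p : N p -> tangent M p w.
Proof. by move=> [Mp wp]; apply/tangentP => //; rewrite formC. Qed.

Lemma linear_section_hypersurface : hypersurface g r N.
Proof.
split=> [p []//|p Np]; exists setT, (form w); split.
- exact: openT.
- by [].
- exact: smooth_form.
- by move=> x _ Mx; split=> [[]|].
move=> x _ Nx; exists w; first exact: linear_section_normal.
by have [_ ->] := is_derive_form x w; rewrite gt_eqF.
Qed.

Lemma linear_section_orientable : orientable g r N.
Proof.
exists (fun=> (Num.sqrt (form w w))^-1 *: w); split.
  by move=> x; exact: cst_continuous.
move=> p Np; have [Mp wp] := Np; split.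
- by apply/tangentP => //; rewrite formZr formC wp mulr0.
- rewrite formZl formZr mulrA -expr2 exprVn sqr_sqrtr ?ltW//.
  by rewrite mulVf// gt_eqF.
- by move=> v /(linear_section_tangentP _ Np)[_ wv]; rewrite formZl wv mulr0.
Qed.

(** The acceleration of a curve in the section is automatically orthogonal to
    [w], which spans the only direction of the quadric not in the section. *)
Lemma linear_section_totally_geodesic : totally_geodesic g r N.
Proof.
move=> J c itvJ J_nondeg [cN cC2 [v Hv]].
have J_acc s : J s -> forall d, 0 < d -> exists u, [/\ J u, u != s & `|u - s| < d].
  by move=> Js d; exact: interval_limit_point.
have wderiv f (l : R -> 'rV[R]_m.+2) :
    (forall s, J s -> has_derivative_on J f s (l s)) ->
    (forall s, J s -> form w (f s) = 0) -> forall s, J s -> form w (l s) = 0.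
  move=> fl wf s Js; have := has_derivative_on_form g (has_derivative_on_cst J w s) (fl s Js).
  rewrite form0l add0r => H; apply: (has_derivative_on_unique (J_acc s Js) H).
  apply: eq_has_derivative_on Js _ (has_derivative_on_cst J (0 : R) s) => u Ju.
  by rewrite wf.
split=> // [s /cN[]//|]; exists v => s Js; have [cv [l [vl _ Hl]]] := Hv s Js.
split=> //; have [Mc wc] := cN s Js; exists l; split=> //.
  by apply/tangentP => //; rewrite form0r.
have wv : forall s, J s -> form w (v s) = 0.
  by apply: (wderiv c) => u Ju; [have [] := Hv u Ju | have [] := cN u Ju].
have wl : form w l = 0.
  have [l' Hl'] : exists l' : R -> 'rV[R]_m.+2, forall u, J u -> has_derivative_on J v u (l' u).
    have H u : exists k, J u -> has_derivative_on J v u k.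
      have [Ju|nJu] := pselect (J u); last by exists 0.
      by have [_ [k [vk _ _]]] := Hv u Ju; exists k.
    by exists (fun u => projT1 (cid (H u))) => u; exact: (projT2 (cid (H u))).
  rewrite (has_derivative_on_unique (J_acc s Js) vl (Hl' s Js)).
  exact: (wderiv v).
move=> u Mu; have cu := tangent_form Mu; rewrite subr0 in Hl *.
pose a := form w u / form w w.
have -> : u = (u - a *: w) + a *: w by rewrite subrK.
rewrite formDr formZr [form l w]formC wl mulr0 addr0; apply: Hl.
apply/linear_section_tangentP => //.
by rewrite !formBr !formZr cu [form _ w]formC wc mulr0 subrr divfK ?subrr// gt_eqF.
Qed.

End LinearSection.

Section Converse.
Variables (R : realType) (g : space_form) (m : nat) (r : R)
  (I : set R) (alpha t : R -> 'rV[R]_m.+2) (n : 'I_m -> R -> 'rV[R]_m.+2)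
  (kappa : 'I_m -> R -> R).
Hypotheses (r_gt0 : 0 < r) (itvI : is_interval I) (I_nondeg : interior I !=set0)
  (alphaC2 : arclength_C2_curve g r I alpha t)
  (frame : rm_frame g r I alpha t n kappa).
Local Notation form := (@ambient_form R m g).

(** The relation makes the corresponding combination of the [n i] a constant
    vector, and the curve stays orthogonal to it. *)
Lemma curvature_relation_hyperplane (a : 'I_m -> R) :
  (exists i, a i != 0) -> (forall s, I s -> \sum_(i < m) a i * kappa i s = 0) ->
  hyperplane_curve g r I alpha.
Proof.
move=> [k ak] Hk; have [s0 /interior_subset Is0] := I_nondeg.
pose w s := \sum_i a i *: n i s.
have dw s : I s -> has_derivative_on I w s 0.
  move=> Is; have := has_derivative_on_sum (fun i => has_derivative_onZ
    (has_derivative_on_cst I (a i) s)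
    (n_derivative r_gt0 itvI I_nondeg alphaC2 frame (i := i) Is)).
  suff -> : \sum_i (0 *: n i s + a i *: (- kappa i s *: t s)) = 0 by [].
  under eq_bigr do rewrite scale0r add0r scalerA mulrN.
  by rewrite -scaler_suml sumrN Hk// oppr0 scale0r.
have w_cst s : I s -> w s = w s0.
  move=> Is; apply/rowP => j.
  apply: (@has_derivative_on0_cst R I (fun u => w u 0 j) itvI _ s s0 Is Is0) => u Iu.
  by have := has_derivative_on_coord (i := j) (dw u Iu); rewrite mxE.
have form_w_n s i : I s -> form (w s) (n i s) = a i.
  move=> Is; rewrite form_suml (bigD1 i)//= big1 => [|j ji].
    by rewrite formZl (form_n_n frame)// eqxx mulr1 addr0.
  by rewrite formZl (form_n_n frame)// (negPf ji) mulr0.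
have ww : form (w s0) (w s0) = \sum_i a i ^+ 2.
  rewrite [X in form _ X]/w form_sumr; apply: eq_bigr => i _.
  by rewrite formZr form_w_n.
have w_gt0 : 0 < form (w s0) (w s0).
  rewrite ww (bigD1 k)//= ltr_wpDr ?sumr_ge0// => [i _|]; first exact: sqr_ge0.
  by rewrite exprn_even_gt0.
exists (linear_section g r (w s0)); split.
- exact: linear_section_hypersurface.
- exact: linear_section_orientable.
- exact: linear_section_totally_geodesic.
move=> s Is; split; first exact: (curve_in_space alphaC2).
rewrite -(w_cst s Is) form_suml big1// => i _.
by rewrite formZl formC (form_alpha_n frame)// mulr0.
Qed.

End Converse.

(** * Hyperplanes of the space of curvatures *)

Section Hyperplanes.
Variables (R : realType) (m : nat).
Hypothesis m_gt0 : (1 <= m)%N.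

Lemma hyperplane_vspaceP (K : set 'rV[R]_m) :
  (exists H : {vspace 'rV[R]_m}, \dim H = m.-1 /\ forall x, K x -> x \in H) <->
  (exists a : 'I_m -> R, (exists i, a i != 0) /\
     forall x, K x -> \sum_(i < m) a i * x 0 i = 0).
Proof.
have dimT : \dim {: 'rV[R]_m} = m by rewrite dimvf /dim/= mul1n.
split=> [[H [dimH KH]]|[a [[k ak] Ka]]].
  have [v vH] : exists v : 'rV[R]_m, v \notin H.
    exists (vpick H^C); apply/negP => vH.
    have : vpick H^C \in (H :&: H^C)%VS by rewrite memv_cap vH memv_pick.
    rewrite capv_compl memv0 vpick0 -dimv_eq0 dimv_compl dimT dimH.
    by case: (m) m_gt0 => // k _; rewrite subSnn.
  (* Some coordinate of the projection along [H] is a linear form that vanishes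
     on [H] but not at [v]. *)
  pose phi := (\1 - projv H)%VF.
  have phiE x : phi x = x - projv H x by rewrite /phi !lfunE/= !lfunE.
  have [i vi] : exists i, phi v 0 i != 0.
    apply/existsP; apply: contraNT vH; rewrite negb_exists => /forallP v0.
    have : phi v = 0 by apply/rowP => i; have := v0 i; rewrite negbK mxE => /eqP.
    by rewrite phiE => /eqP; rewrite subr_eq0 => /eqP ->; exact: memv_proj.
  exists (fun j => phi (delta_mx 0 j) 0 i).
  have sumE (x : 'rV[R]_m) : \sum_j phi (delta_mx 0 j) 0 i * x 0 j = phi x 0 i.
    rewrite {2}[x]row_sum_delta linear_sum summxE; apply: eq_bigr => j _.
    by rewrite linearZ mxE mulrC.
  split; last by move=> x Kx; rewrite sumE phiE projv_id ?subrr ?mxE// KH.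
  apply/existsP; apply: contraNT vi; rewrite negb_exists => /forallP a0.
  rewrite -sumE big1// => j _; have := a0 j; rewrite negbK => /eqP ->.
  by rewrite mul0r.
pose phi : 'Hom('rV[R]_m, 'rV[R]_1) := linfun (mulmxr (\col_i a i)).
have phiE x : phi x 0 0 = \sum_i a i * x 0 i.
  by rewrite lfunE/= mxE; apply: eq_bigr => i _; rewrite mxE mulrC.
exists (lker phi); split; last first.
  move=> x Kx; rewrite memv_ker; apply/eqP/rowP => j.
  by rewrite ord1 phiE Ka// mxE.
have := limg_ker_dim phi fullv; rewrite capfv dimT.
suff -> : \dim (limg phi) = 1%N by move/(congr1 predn); rewrite addn1.
apply/eqP; rewrite eqn_leq; apply/andP; split.
  by rewrite (leq_trans (dimvS (subvf _)))// dimvf /dim/= mul1n.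
rewrite lt0n dimv_eq0; apply/eqP => phi0.
have : phi (delta_mx 0 k) \in limg phi by rewrite memv_img// memvf.
rewrite phi0 memv0 => /eqP/rowP/(_ 0); rewrite phiE (bigD1 k)//= big1 => [|i ik].
  by rewrite !mxE !eqxx mulr1 addr0 => /eqP; rewrite (negPf ak).
by rewrite mxE (negPf ik) andbF mulr0.
Qed.

End Hyperplanes.

Theorem theorem6 (R : realType) (g : space_form) (m : nat) (r : R)
    (I : set R) (alpha t : R -> 'rV[R]_m.+2) (n : 'I_m -> R -> 'rV[R]_m.+2)
    (kappa : 'I_m -> R -> R)
    (m_ge1 : (1 <= m)%N) (r_gt0 : 0 < r)
    (itvI : is_interval I) (I_nondeg : interior I !=set0)
    (alphaC2 : arclength_C2_curve g r I alpha t)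
    (frame : rm_frame g r I alpha t n kappa) :
  (hyperplane_curve g r I alpha <->
     exists H : {vspace 'rV[R]_m},
       \dim H = m.-1 /\
       forall s, I s -> normal_development kappa s \in H) /\
  (hyperplane_curve g r I alpha <->
     exists a : 'I_m -> R,
       (exists i, a i != 0) /\
       forall s, I s -> \sum_(i < m) a i * kappa i s = 0).
Proof.
have curvesP : hyperplane_curve g r I alpha <-> exists a : 'I_m -> R,
    (exists i, a i != 0) /\ forall s, I s -> \sum_(i < m) a i * kappa i s = 0.
  split=> [[N [hyp [eta [_ eta_n]] tg aN]]|[a [a0 Ha]]].
    exact: (hypersurface_curvatures r_gt0 itvI I_nondeg alphaC2 frame hyp tg aN eta_n).
  exact: (curvature_relation_hyperplane r_gt0 itvI I_nondeg alphaC2 frame a0 Ha).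
split=> //; apply: (iff_trans curvesP).
have [H1 H2] := hyperplane_vspaceP m_ge1 (normal_development kappa @` I).
have ndE (a : 'I_m -> R) s :
    \sum_(i < m) a i * normal_development kappa s 0 i = \sum_(i < m) a i * kappa i s.
  by apply: eq_bigr => i _; rewrite mxE.
split=> [[a [a0 Ha]]|[H [dimH KH]]].
  have [|H [dimH KH]] := H2.
    by exists a; split=> // _ [s Is <-]; rewrite ndE Ha.
  by exists H; split=> // s Is; apply: KH; exists s.
have [|a [a0 Ha]] := H1; first by exists H; split=> // _ [s Is <-]; exact: KH.
by exists a; split=> // s Is; rewrite -ndE Ha//; exists s.
Qed.
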